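(* Consider the golf process on $\mathbb{Z}$ with parameters $\rho_b,\rho_h,p$ where $\rho_b+\rho_h=1$ and $\rho_b<\rho_h$, and let $\lambda=\rho_b\rho_h$. Then for every $R>0$ and every $(b_i)_{-R\le i\le R}\in\mathbb{N}^{2R+1}$, $$\mathbb{P}\left(\Delta_iH^1=2b_i,\ -R\le i\le R\right)=\frac{(2b_0+1)C_{b_0}\lambda^{b_0}}{\mathcal{H}(\lambda)}\prod_{i=-R,\,i\ne0}^{R}\frac{C_{b_i}\lambda^{b_i}}{\mathcal{G}(\lambda)},$$ where $C_k=\frac{1}{k+1}\binom{2k}{k}$, $\mathcal{G}(a)=\sum_{k\ge0}C_ka^k=\frac{1-\sqrt{1-4a}}{2a}$ and $\mathcal{H}(a)=\sum_{k\ge0}(2k+1)C_ka^k=2a\mathcal{G}'(a)+\mathcal{G}(a)$ for $a\in(0,1/4]$. In particular the $\Delta_iH^1$ are independent, $\mathbb{P}(\Delta_iH^1=2b)=C_b\lambda^b/\mathcal{G}(\lambda)$ for $i\ne0$, and $\mathbb{P}(\Delta_0H^1=2b)=(2b+1)C_b\lambda^b/\mathcal{H}(\lambda)$.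
   Context: Golf process on $\mathbb{Z}$: initial states i.i.d., ball with probability $\rho_b$, hole with probability $\rho_h$, neutral otherwise; clocks i.i.d. uniform on $[0,1]$; at its clock time each ball performs an independent random walk (step $+1$ w.p. $p$, $-1$ w.p. $1-p$) from its vertex, stopped at the first currently free hole, which it fills (this process is well defined almost surely when $\rho_b\le\rho_h$). $H^1$ denotes the set of holes still free at time $1$; under the hypotheses it is a.s. infinite in both directions. Index it increasingly as $(H^1_i)_{i\in\mathbb{Z}}$ where $H^1_0$ is the largest nonpositive element, and set $\Delta_iH^1=H^1_{i+1}-H^1_i-1$. *)

(* Defs.v *)
From HB Require Import structures.
From mathcomp Require Import all_boot all_order all_algebra.
From mathcomp Require Import all_classical all_reals all_analysis.
Set Implicit Arguments. Unset Strict Implicit. Unset Printing Implicit Defensive.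
Import Order.TTheory GRing.Theory Num.Theory.
Local Open Scope classical_set_scope.
Local Open Scope ring_scope.

Inductive site := Ball | Hole | Neutral.

Definition site_code (s : site) : nat :=
  match s with Ball => 0 | Hole => 1 | Neutral => 2 end.
Definition code_site (n : nat) : site :=
  match n with 0 => Ball | 1 => Hole | _ => Neutral end.
Lemma site_codeK : cancel site_code code_site. Proof. by case. Qed.
HB.instance Definition _ := Equality.copy site (can_type site_codeK).

(* real encoding of a site (used only to express independence) *)
Definition site_to_R {R : realType} (s : site) : R := (site_code s)%:R.

Section Dynamics.
Variable R : realType.
Variables (st : int -> site) (clk : int -> R) (stp : int -> nat -> bool).

Definition walk (x : int) (n : nat) : int :=
  x + \sum_(k < n) (if stp x k then 1 else -1).

Definition first_hit (F : set int) (x y : int) : Prop :=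
  F y /\ exists n : nat, walk x n = y /\ forall m : nat, (m < n)%N -> ~ F (walk x m).

Definition fire (F : set int) (x : int) : set int :=
  [set y | F y /\ ~ first_hit F x y].

Definition initial_holes : set int := [set y | st y = Hole].

Definition window_balls (n : nat) : seq int :=
  [seq x <- [seq (i%:Z - n%:Z) | i <- iota 0 (n.*2.+1)]
     | (st x == Ball) && (clk x <= 1)].

(* order of activation: by clock time (ties, a null event, broken by position) *)
Definition clock_order (x y : int) : bool :=
  (clk x < clk y) || ((clk x == clk y) && (x <= y)).

Definition free_window (n : nat) : set int :=
  foldl fire initial_holes (sort clock_order (window_balls n)).

(* H^1 : holes free at time 1 of the process on Z, obtained as the limit of the
   window processes (a site is in H^1 iff it is free for all large windows). *)
Definition H1 : set int :=
  [set y | exists N : nat, forall n : nat, (N <= n)%N -> free_window n y].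

(* The event  {Delta_i H^1 = 2 b_i, -R <= i <= R}, where (H^1_i) is the increasing
   enumeration of H^1 with H^1_0 the largest nonpositive element:
   h i plays the role of H^1_i for -R <= i <= R+1. *)
Definition gaps_event (Rr : nat) (b : int -> nat) : Prop :=
  exists h : int -> int,
    h 0 <= 0 /\ 0 < h 1 /\
    forall i : int, - (Rr%:Z) <= i <= Rr%:Z ->
      [/\ H1 (h i), H1 (h (i + 1)), h i < h (i + 1),
          (forall y, h i < y < h (i + 1) -> ~ H1 y) &
          h (i + 1) - h i - 1 = ((b i).*2)%:Z].

End Dynamics.

Definition golf_index := ((int + int) + (int * nat))%type.

Definition golf_rv {d} {T : measurableType d} {R : realType}
  (st : int -> T -> site) (clk : int -> T -> R) (stp : int -> nat -> T -> bool)
  (i : golf_index) : T -> R :=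
  match i with
  | inl (inl x) => fun w => site_to_R (st x w)
  | inl (inr x) => clk x
  | inr (x, k) => fun w => if stp x k w then 1 else 0
  end.

Definition mutually_independent {d} {T : measurableType d} {R : realType}
  (P : probability T R) (I : eqType) (X : I -> T -> R) : Prop :=
  (forall i, measurable_fun setT (X i)) /\
  forall (s : seq I), uniq s -> forall B : I -> set R, (forall i, measurable (B i)) ->
    fine (P (\bigcap_(i in [set` s]) (X i @^-1` B i)))
    = \prod_(i <- s) fine (P (X i @^-1` B i)).

Definition golf_randomness {d} {T : measurableType d} {R : realType}
  (P : probability T R) (rb rh p : R)
  (st : int -> T -> site) (clk : int -> T -> R) (stp : int -> nat -> T -> bool) : Prop :=
  [/\ mutually_independent P (golf_rv st clk stp),
      (forall x, P [set w | st x w = Ball] = rb%:E /\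
                 P [set w | st x w = Hole] = rh%:E /\
                 P [set w | st x w = Neutral] = (1 - rb - rh)%:E),
      (forall x (t : R), 0 <= t <= 1 -> P [set w | clk x w <= t] = t%:E) &
      (forall x k, P [set w | stp x k w] = p%:E)].

Definition catalan {R : realType} (k : nat) : R := ('C(k.*2, k))%:R / (k.+1)%:R.

Definition Gfun {R : realType} (a : R) : R :=
  limn (series (fun k : nat => (catalan k * a ^+ k : R^o))).

Definition Hfun {R : realType} (a : R) : R :=
  limn (series (fun k : nat => ((k.*2.+1)%:R * catalan k * a ^+ k : R^o))).

(* Main.v *)
Require Import Defs.
From HB Require Import structures.
From mathcomp Require Import all_boot all_order all_algebra.
From mathcomp Require Import all_classical all_reals all_analysis.
From mathcomp Require Import zify ring measurable_realfun.
Import Order.TTheory GRing.Theory Num.Theory numFieldNormedType.Exports.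
Local Open Scope classical_set_scope.
Local Open Scope ring_scope.
Set Implicit Arguments. Unset Strict Implicit. Unset Printing Implicit Defensive.

(** A hole that stays free is never crossed by a walk, so given that [c] starts as a hole,
    [c] is free at time 1 iff it is free in the two processes restricted to the left and
    to the right of [c], and these are independent. Hence the probability of a given
    sequence of consecutive gaps factorises into one factor per gap, two factors for the
    half lines and one factor [rh] per free hole.

    The factor of a gap of length [2 * b] is computed on the cycle of length [2 * b + 1],
    where the two end holes are identified: exactly one hole stays free iff there are [b]
    balls, and by rotation invariance it is uniform, so the factor is
    ['C(2 * b + 1, b) / (2 * b + 1) * lam ^ b = catalan b * lam ^ b], whatever [p] is.

    Write [K] for the probability that [0] is free at time 1, times [rh]. Each ball fills
    at most one hole, so [K >= rh * (rh - rb)]; the events that the gap around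
    the origin is [2 * b] are disjoint, so [K * H(lam) <= 1]. The Catalan convolution gives
    [G(lam) = 1 / rh] and [H(lam) = 1 / (rh * (rh - rb))], whence [K = 1 / H(lam)]. *)

(** * Firing balls one at a time *)

(** The set [H1] is a limit of finite systems, and the proof must reach it without ordering
    infinitely many firings. The tool is monotonicity: removing a ball can only enlarge the set of
    free holes. Hence being free in all large windows is the same as being free for every finite
    list of balls ([finalP]). This is a countable intersection, so the splitting at a free hole is
    proved for finite lists and passes to the limit at once. The parameter [p] disappears because on
    a cycle almost every walk reaches a free hole as long as one is left: the number of free holes
    is then deterministic given the initial states, and only their positions depend on the walks.
    Rotation invariance takes care of the positions. The factor [2 * b + 1] is the number of
    possible positions [-j], with [0 <= j <= 2 * b], of the left end of a gap around the origin; all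
    have the same probability because that of a chain of gaps does not depend on where it starts.
    The bound [K * H(lam) <= 1] is used twice: it bounds the partial sums of the series for
    [H(lam)], which gives convergence, and then it gives the upper bound on [K]. *)

Section Firing.
Variable tr : int -> nat -> int.
Implicit Types (F : set int) (x y : int) (s : seq int).

(** The trajectories [tr] are left abstract so that the same lemmas serve [walk] on the integers,
    where [hits] and [gfire] unfold to [first_hit] and [fire], and its reduction modulo [N] on the
    cycle. *)
Definition hits F x y : Prop :=
  F y /\ exists n : nat, tr x n = y /\ forall m : nat, (m < n)%N -> ~ F (tr x m).

Definition gfire F x : set int := [set y | F y /\ ~ hits F x y].

Definition gfires F s : set int := foldl gfire F s.

Lemma hits_unique F x y z : hits F x y -> hits F x z -> y = z.
Proof.
move=> [Fy [n [ny hn]]] [Fz [m [mz hm]]].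
case: (ltngtP n m) => [nm|mn|e].
- by case: (hm n nm); rewrite ny.
- by case: (hn m mn); rewrite mz.
- by rewrite -ny -mz e.
Qed.

Lemma hitsP F x n : F (tr x n) -> exists y, hits F x y.
Proof.
move=> Fn; have ex : exists n, `[< F (tr x n) >] by exists n; apply/asboolP.
case: (ex_minnP ex) => m /asboolP Fm mmin; exists (tr x m).
split => //; exists m; split => // k km Fk.
by have := mmin k (introT (asboolP _) Fk); rewrite leqNgt km.
Qed.

Lemma gfire_sub F x : gfire F x `<=` F. Proof. by move=> y []. Qed.

(** A trajectory that avoids the larger set [F'] before reaching [y] also avoids [F], so a hole of
    [F] filled in the richer configuration is filled in the poorer one too. *)
Lemma gfire_mono F F' x : F `<=` F' -> gfire F x `<=` gfire F' x.
Proof.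
move=> FF' y [Fy nh]; split; first exact: FF'.
move=> [_ [n [ny hn]]]; apply: nh; split => //; exists n; split => // m mn Fm.
exact: (hn m mn (FF' _ Fm)).
Qed.

Lemma gfires_sub F s : gfires F s `<=` F.
Proof.
elim: s F => [|x s IH] F //=.
by apply: subset_trans (IH _) _; apply: gfire_sub.
Qed.

Lemma gfires_mono F F' s : F `<=` F' -> gfires F s `<=` gfires F' s.
Proof. by elim: s F F' => [|x s IH] F F' FF' //=; apply/IH/gfire_mono. Qed.

(** Skipping a ball leaves a larger set of holes, and [gfires_mono] keeps it larger through all
    later firings. This is the monotonicity behind the infinite-volume limit. *)
Lemma gfires_subseq F s s' : subseq s s' -> gfires F s' `<=` gfires F s.
Proof.
elim: s' F s => [|x s' IH] F [|z s] // ss.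
- by [].
- exact: gfires_sub.
- move: ss => /=; case: eqP => [->|_] ss; first exact: IH.
  exact: subset_trans (IH _ _ ss) (@gfires_mono _ _ (z :: s) (@gfire_sub _ _)).
Qed.

(** Localisation: a trajectory that can leave [A] only after meeting [F] sees nothing of the holes
    outside [A]. *)
Lemma hits_agree F F' (A : set int) x :
  (forall n, (forall m, (m < n)%N -> ~ F (tr x m)) -> A (tr x n)) ->
  (forall y, A y -> (F y <-> F' y)) ->
  forall y, hits F x y <-> hits F' x y.
Proof.
move=> stay agree.
(* Confinement is assumed for [F] only. It transfers to [F'] by strong induction on time: while [F]
   has been avoided the trajectory is in [A], where both sets agree. *)
have avoid n : (forall m, (m < n)%N -> ~ F' (tr x m)) ->
    forall m, (m < n)%N -> ~ F (tr x m).
  move=> hn m; elim/ltn_ind: m => m IH mn Fm.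
  apply: (hn m mn); apply/agree => //; apply: stay => k km.
  by apply: IH => //; apply: ltn_trans mn.
move=> y; split=> -[Fy [n [ny hn]]].
- have Ay : A y by rewrite -ny; apply: stay.
  split; first exact/agree.
  exists n; split => // m mn F'm; apply: (hn m mn); apply/agree => //.
  by apply: stay => k km; apply: hn; apply: ltn_trans mn.
- have Ay : A y by rewrite -ny; apply: stay; apply: avoid.
  split; first exact/agree.
  by exists n; split => //; apply: avoid.
Qed.

Lemma hits_stay F (A : set int) x y :
  (forall n, (forall m, (m < n)%N -> ~ F (tr x m)) -> A (tr x n)) ->
  hits F x y -> A y.
Proof. by move=> stay [_ [n [<- hn]]]; apply: stay. Qed.

End Firing.

Lemma eq_gfires tr tr' F s : {in s, forall x, tr x = tr' x} ->
  gfires tr F s = gfires tr' F s.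
Proof.
elim: s F => [|x s IH] F h //=.
have -> : gfire tr F x = gfire tr' F x.
  by rewrite /gfire /hits h ?mem_head.
by apply: IH => z zs; apply: h; rewrite inE zs orbT.
Qed.

(** Equivariance under relabelling, used for translations with [A] the whole line and for rotations
    with [A] the sites of the cycle, which the reduced walks never leave. *)
Lemma gfires_relabel tr tr' (f : int -> int) (A : set int) F F' s y :
  {in s, forall x, A x} -> (forall x n, A x -> A (tr' x n)) ->
  (forall x n, A x -> tr (f x) n = f (tr' x n)) ->
  (forall u v, A u -> A v -> f u = f v -> u = v) ->
  (forall u, A u -> (F' u <-> F (f u))) ->
  A y -> gfires tr' F' s y <-> gfires tr F (map f s) (f y).
Proof.
move=> sA stay ftr finj; elim: s F F' sA => [|x s IH] F F' sA FF' Ay /=.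
  exact: FF'.
apply: IH => //; first by move=> z zs; apply: sA; rewrite inE zs orbT.
move=> u Au; have Ax := sA _ (mem_head _ _).
rewrite /gfire /=; split=> -[Fu nh]; split; try exact/FF'; move=> [_ [n [nu hn]]].
- apply: nh; split => //; exists n; split.
    by apply: finj => //; [apply: stay|rewrite -ftr].
  by move=> m mn F'm; apply: (hn m mn); rewrite ftr //; apply/FF' => //; exact: stay.
- apply: nh; split => //; exists n; split; first by rewrite ftr // nu.
  by move=> m mn; rewrite ftr // => F'm; apply: (hn m mn); apply/FF' => //; exact: stay.
Qed.

(** * The two sides of a free hole do not interact *)

Section Splitting.
Variable stp : int -> nat -> bool.

Lemma walk0 x : walk stp x 0 = x.
Proof. by rewrite /walk big_ord0 addr0. Qed.

Lemma walkS x n : walk stp x n.+1 = walk stp x n + (if stp x n then 1 else -1).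
Proof. by rewrite /walk big_ord_recr /= addrA. Qed.

(* A nearest-neighbour walk started in [A] can leave [A] only through a site of [F]. *)
Definition enclosed (F A : set int) :=
  forall y, A y -> ~ F y -> A (y + 1) /\ A (y - 1).

Lemma walk_stay F A x n : enclosed F A -> A x ->
  (forall m, (m < n)%N -> ~ F (walk stp x m)) -> A (walk stp x n).
Proof.
move=> enc Ax; elim: n => [|n IH] hn; first by rewrite walk0.
have An : A (walk stp x n) by apply: IH => m mn; apply: hn; apply: ltnW.
have [A1 A2] := enc _ An (hn n (ltnSn n)).
by rewrite walkS; case: ifP.
Qed.

Lemma enclosed_le c F : F c -> enclosed F [set y | y <= c].
Proof.
move=> Fc y /= yc nFy; have yc' : y <> c by move=> e; rewrite e in nFy.
by split; lia.
Qed.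

Lemma enclosed_ge c F : F c -> enclosed F [set y | c <= y].
Proof.
move=> Fc y /= yc nFy; have yc' : y <> c by move=> e; rewrite e in nFy.
by split; lia.
Qed.

(** A ball starting in [A] fills at most one hole, and that hole is in [A]. If it is not [c], the
    only common site, then [A'] is untouched. Keeping [A] and [A'] abstract allows exchanging the
    two sides. *)
Lemma gfire_split_step (A A' F F1 F2 : set int) c x :
  (forall y, A y -> A' y -> y = c) ->
  (forall G, G c -> enclosed G A) -> A c ->
  F c -> F1 c ->
  (forall y, A y -> (F y <-> F1 y)) -> (forall y, A' y -> (F y <-> F2 y)) ->
  A x ->
  [/\ (forall y, A y -> (gfire (walk stp) F x y <-> gfire (walk stp) F1 x y)),
      gfire (walk stp) F x c <-> gfire (walk stp) F1 x c &
      gfire (walk stp) F x c ->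
      forall y, A' y -> (gfire (walk stp) F x y <-> F2 y)].
Proof.
move=> AA' enc Ac Fc F1c e1 e2 Ax.
have stay n : (forall m, (m < n)%N -> ~ F (walk stp x m)) -> A (walk stp x n).
  exact: walk_stay (enc _ Fc) Ax.
have hE := hits_agree stay e1.
have gE y : A y -> (gfire (walk stp) F x y <-> gfire (walk stp) F1 x y).
  move=> Ay; rewrite /gfire /=; split=> -[h1 h2]; split; try exact/(e1 _ Ay);
  by move=> /hE.
split => //; first exact: gE.
move=> [_ nhc] y A'y; split=> [[/e2 - /(_ A'y)]//|F2y].
split; first exact/e2.
move=> h; have Ay := hits_stay stay h.
by apply: nhc; rewrite -(AA' y Ay A'y).
Qed.

(* As long as [c] is free no walk passes it, so that the two sides do not interact;
   once [c] is filled both sides of the equivalence are false forever. *)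
Lemma gfires_split (A A' : set int) (a a' : pred int) F F1 F2 c s :
  (forall y, A y -> A' y -> y = c) ->
  (forall G, G c -> enclosed G A) -> (forall G, G c -> enclosed G A') ->
  A c -> A' c ->
  {in s, forall x, a' x = ~~ a x} ->
  (forall x, a x -> A x) -> (forall x, a' x -> A' x) ->
  F c -> F1 c -> F2 c ->
  (forall y, A y -> (F y <-> F1 y)) -> (forall y, A' y -> (F y <-> F2 y)) ->
  (gfires (walk stp) F s c <->
     gfires (walk stp) F1 [seq x <- s | a x] c /\ gfires (walk stp) F2 [seq x <- s | a' x] c)
  /\ (gfires (walk stp) F s c ->
      (forall y, A y ->
        (gfires (walk stp) F s y <-> gfires (walk stp) F1 [seq x <- s | a x] y)) /\
      (forall y, A' y ->
        (gfires (walk stp) F s y <-> gfires (walk stp) F2 [seq x <- s | a' x] y))).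
Proof.
move=> AA' encA encA' Ac A'c + aA aA'.
elim: s F F1 F2 => [|x s IH] F F1 F2 aa' Fc F1c F2c e1 e2.
  by split=> //=; split=> // _; split.
have aa's : {in s, forall x, a' x = ~~ a x}.
  by move=> z zs; apply: aa'; rewrite inE zs orbT.
have xs := aa' _ (mem_head _ _).
have dead G t : ~ G c -> ~ gfires (walk stp) G t c.
  by move=> nG /gfires_sub.
case ax : (a x); rewrite ax /= in xs; rewrite /= ax xs /=.
- have [g1 gc g2] := gfire_split_step AA' encA Ac Fc F1c e1 e2 (aA _ ax).
  have [Fxc|nFxc] := pselect (gfire (walk stp) F x c).
    by apply: IH => //; [apply/gc|apply: g2].
  have nF1 : ~ gfire (walk stp) F1 x c by move=> /gc.
  split; last by move=> /(dead _ _ nFxc).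
  by split=> [/(dead _ _ nFxc)|[/(dead _ _ nF1)]].
- have AA'' y : A' y -> A y -> y = c by move=> *; apply: AA'.
  have [g1 gc g2] := gfire_split_step AA'' encA' A'c Fc F2c e2 e1 (aA' _ xs).
  have [Fxc|nFxc] := pselect (gfire (walk stp) F x c).
    by apply: IH => //; [apply/gc|apply: g2].
  have nF2 : ~ gfire (walk stp) F2 x c by move=> /gc.
  split; last by move=> /(dead _ _ nFxc).
  by split=> [/(dead _ _ nFxc)|[_ /(dead _ _ nF2)]].
Qed.

End Splitting.

(** * Environments and the process on the integers *)

Record env (R : realType) :=
  Env { est : int -> site; eclk : int -> R; estp : int -> nat -> bool }.

Definition index_site (i : golf_index) : int :=
  match i with inl (inl x) => x | inl (inr x) => x | inr (x, _) => x end.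

Section Environment.
Variable R : realType.
Implicit Types (w : env R) (s : seq int) (a : pred int) (c x y : int).

Definition active w x := (est w x == Ball) && (eclk w x <= 1).

Definition schedule w s := sort (clock_order (eclk w)) [seq x <- s | active w x].

Definition holes_after w s : set int :=
  gfires (walk (estp w)) (initial_holes (est w)) (schedule w s).

Definition final w : set int := H1 (est w) (eclk w) (estp w).

(* The sites outside [D] become holes, hence carry no ball: what is left is the
   process inside [D], surrounded by holes. *)
Definition restrict (D : pred golf_index) w : env R :=
  Env (fun x => if D (inl (inl x)) then est w x else Hole)
      (fun x => if D (inl (inr x)) then eclk w x else 0)
      (fun x k => if D (inr (x, k)) then estp w x k else false).

Definition on_sites a : pred golf_index := fun i => a (index_site i).

Definition restr a w := restrict (on_sites a) w.

Definition reindex (f : int -> int) w : env R :=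
  Env (est w \o f) (eclk w \o f) (estp w \o f).

Definition shift (r : int) := reindex (fun x => x + r).

Lemma clock_order_total w : total (clock_order (eclk w)).
Proof.
move=> x y; rewrite /clock_order.
case: (ltgtP (eclk w x) (eclk w y)) => //= _; exact: le_total.
Qed.

Lemma clock_order_trans w : transitive (clock_order (eclk w)).
Proof.
move=> y x z; rewrite /clock_order.
case: (ltgtP (eclk w x) (eclk w y)) => //= [xy _|->].
- case: (ltgtP (eclk w y) (eclk w z)) => //= [yz|<-] _; last by rewrite xy.
  by rewrite (lt_trans xy yz).
- case: (ltgtP (eclk w y) (eclk w z)) => //= _; exact: le_trans.
Qed.

Lemma clock_order_anti w : antisymmetric (clock_order (eclk w)).
Proof.
move=> x y; rewrite /clock_order.
by case: (ltgtP (eclk w x) (eclk w y)) => //= _ /andP[? ?]; apply/eqP; lia.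
Qed.

(** Breaking ties by position makes [clock_order] antisymmetric, so the sorted list does not depend
    on the order of its input. *)
Lemma schedule_perm w s t : perm_eq s t -> schedule w s = schedule w t.
Proof.
move=> st; apply/perm_sortP; [exact: clock_order_total|exact: clock_order_trans|
  exact: clock_order_anti|exact: perm_filter].
Qed.

Lemma mem_schedule w s x : (x \in schedule w s) = active w x && (x \in s).
Proof. by rewrite mem_sort mem_filter. Qed.

Lemma schedule_subseq w s t : uniq s -> uniq t -> {subset s <= t} ->
  subseq (schedule w s) (schedule w t).
Proof.
move=> us ut st.
have -> : schedule w s = schedule w [seq x <- t | x \in s].
  apply: schedule_perm; apply: uniq_perm => //; first exact: filter_uniq.
  by move=> x; rewrite mem_filter; case: (boolP (x \in s)) => // /st ->.
rewrite /schedule -filter_predI.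
rewrite (_ : seq.filter (predI _ _) t =
  [seq x <- [seq x <- t | active w x] | x \in s]); last first.
  by rewrite -filter_predI; apply: eq_filter => x /=; rewrite andbC.
apply: subseq_sort; [exact: clock_order_total|exact: clock_order_trans|].
exact: filter_subseq.
Qed.

Lemma holes_after_anti w s t : uniq s -> uniq t -> {subset s <= t} ->
  holes_after w t `<=` holes_after w s.
Proof. by move=> us ut st; apply/gfires_subseq/schedule_subseq. Qed.

Definition window n : seq int := [seq (i%:Z - n%:Z) | i <- iota 0 (n.*2.+1)].

Lemma mem_window n x : (x \in window n) = (`|x| <= n%:Z).
Proof.
apply/mapP/idP => [[i]|xn]; first by rewrite mem_iota => h ->; lia.
by exists (absz (x + n%:Z)); [rewrite mem_iota|]; lia.
Qed.

Lemma window_uniq n : uniq (window n).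
Proof. by rewrite map_inj_uniq ?iota_uniq // => i j; lia. Qed.

Lemma subset_window s : exists N, forall n, (N <= n)%N -> {subset s <= window n}.
Proof.
elim: s => [|x s [N IH]]; first by exists 0%N.
exists (maxn N (absz x)) => n; rewrite geq_max => /andP[Nn xn] z.
rewrite inE => /predU1P[->|/(IH _ Nn)//]; rewrite mem_window; lia.
Qed.

(** Every finite list lies in all large windows, and more balls leave fewer holes. The eventual
    condition defining [H1] thus becomes a universal one, which is measurable and a decreasing
    limit. *)
Lemma finalP w y : final w y <-> forall s, uniq s -> holes_after w s y.
Proof.
split=> [[N h] s us|h].
- have [M hM] := subset_window s.
  have Mm : (M <= maxn N M)%N by rewrite leq_maxr.
  apply: (holes_after_anti us (window_uniq (maxn N M)) (hM _ Mm)).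
  by apply: h; rewrite leq_maxl.
- by exists 0%N => n _; exact: (h _ (window_uniq n)).
Qed.

Lemma final_hole w y : final w y -> est w y = Hole.
Proof. by move=> /finalP /(_ [::] isT). Qed.

Lemma eq_sort_clock w (le' : rel int) s : total le' ->
  {in s &, clock_order (eclk w) =2 le'} -> sort (clock_order (eclk w)) s = sort le' s.
Proof.
move=> tot' e; apply: (sorted_eq (@clock_order_trans w) (@clock_order_anti w)).
- exact: sort_sorted (@clock_order_total w) _.
- rewrite (eq_in_sorted (P := mem s) (e' := le')) //.
    exact: sort_sorted.
  by apply/allP => x; rewrite mem_sort.
- by rewrite perm_sort perm_sym perm_sort.
Qed.

Lemma schedule_restr a w s : schedule (restr a w) s = [seq x <- schedule w s | a x].
Proof.
rewrite /schedule filter_sort; [|exact: clock_order_total|exact: clock_order_trans].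
have e : [seq x <- s | active (restr a w) x] = [seq x <- [seq x <- s | active w x] | a x].
  rewrite -filter_predI; apply: eq_filter => x /=.
  by rewrite /active /restr /= /on_sites /=; case: (a x).
rewrite e; apply: eq_sort_clock; first exact: clock_order_total.
move=> x y; rewrite !mem_filter => /andP[xa _] /andP[ya _].
by rewrite /clock_order /restr /= /on_sites /= xa ya.
Qed.

Lemma holes_after_restr a w s : holes_after (restr a w) s =
  gfires (walk (estp w)) (initial_holes (est (restr a w)))
    [seq x <- schedule w s | a x].
Proof.
rewrite /holes_after schedule_restr; apply: eq_gfires => x.
rewrite mem_filter => /andP[ax _]; apply/funext => n; rewrite /walk.
by congr (_ + _); apply: eq_bigr => k _; rewrite /= /on_sites /= ax.
Qed.

(** Instance of [gfires_split] for the two closed half lines at [c]. Each restriction turns [c] into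
    a hole, which changes nothing here because [c] already is one. *)
Lemma holes_after_split w c s : est w c = Hole ->
  (holes_after w s c <-> holes_after (restr (< c) w) s c /\ holes_after (restr (> c) w) s c) /\
  (holes_after w s c ->
    (forall y, y <= c -> (holes_after w s y <-> holes_after (restr (< c) w) s y)) /\
    (forall y, c <= y -> (holes_after w s y <-> holes_after (restr (> c) w) s y))).
Proof.
move=> hc; rewrite !holes_after_restr.
apply: (@gfires_split _ [set y | y <= c] [set y | c <= y] (< c) (> c)) => //=.
- by move=> y; lia.
- exact: enclosed_le.
- exact: enclosed_ge.
- move=> x; rewrite mem_schedule => /andP[/andP[/eqP xB _] _].
  have xc : x <> c by move=> e; rewrite e hc in xB.
  by rewrite ?inE /=; lia.
- by move=> x; rewrite ?inE; lia.
- by move=> x; rewrite ?inE; lia.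
- by rewrite /initial_holes /= /on_sites /= ?inE ltxx.
- by rewrite /initial_holes /= /on_sites /= ?inE ltxx.
- move=> y yc; rewrite /initial_holes /= /on_sites /= ?inE.
  by case: (ltgtP y c) yc => // ->.
- move=> y yc; rewrite /initial_holes /= /on_sites /= ?inE.
  by case: (ltgtP y c) yc => // ->.
Qed.

Lemma final_split w c : est w c = Hole ->
  (final w c <-> final (restr (< c) w) c /\ final (restr (> c) w) c) /\
  (final w c ->
    (forall y, y <= c -> (final w y <-> final (restr (< c) w) y)) /\
    (forall y, c <= y -> (final w y <-> final (restr (> c) w) y))).
Proof.
move=> hc; split.
  split=> [/finalP h|[/finalP h1 /finalP h2]].
    by split; apply/finalP => s us; apply (holes_after_split s hc).1; apply: h.
  by apply/finalP => s us; apply (holes_after_split s hc).1; split; [apply: h1|apply: h2].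
move=> /finalP h; split=> y yc; split=> /finalP hy; apply/finalP => s us;
have [h1 h2] := (holes_after_split s hc).2 (h s us).
- by apply (h1 _ yc); apply: hy.
- by apply (h1 _ yc); apply: hy.
- by apply (h2 _ yc); apply: hy.
- by apply (h2 _ yc); apply: hy.
Qed.

Lemma holes_after_shift r w s y :
  holes_after (shift r w) s y <-> holes_after w [seq x + r | x <- s] (y + r).
Proof.
rewrite /holes_after (_ : schedule w _ = [seq x + r | x <- schedule (shift r w) s]).
  apply: (@gfires_relabel _ _ _ setT) => // x.
    move=> n _; rewrite /walk addrAC; congr (_ + _ + _).
  by move=> v _ _ /addIr.
rewrite /schedule filter_map sort_map; congr map.
rewrite (_ : _ (relpre _ _) = clock_order (eclk (shift r w))) //.
by apply/funext => u; apply/funext => v; rewrite /clock_order /= lerD2r.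
Qed.

Lemma final_shift r w y : final (shift r w) y <-> final w (y + r).
Proof.
split=> /finalP h; apply/finalP => s us.
- have := h [seq x - r | x <- s]; rewrite map_inj_uniq //; last by move=> ? ? /addIr.
  move=> /(_ us) /holes_after_shift; rewrite -map_comp (_ : _ \o _ = id) ?map_id //.
  by apply/funext => x /=; rewrite subrK.
- apply/holes_after_shift; apply: h; rewrite map_inj_uniq //; last by move=> ? ? /addIr.
Qed.

Lemma restr_shift a r w : restr a (shift r w) = shift r (restr (fun x => a (x - r)) w).
Proof.
rewrite /restr /restrict /shift /reindex /=; congr Env; apply/funext => x /=.
- by rewrite /on_sites /= addrK.
- by rewrite /on_sites /= addrK.
- by apply/funext => k; rewrite /on_sites /= addrK.
Qed.

Lemma eq_restr a a' w : a =1 a' -> restr a w = restr a' w.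
Proof.
move=> e; rewrite /restr; congr restrict; apply/funext => i; exact: e.
Qed.

Lemma restr_restr a a' w : restr a (restr a' w) = restr (predI a a') w.
Proof.
rewrite /restr /restrict /=; congr Env; apply/funext => x.
- by rewrite /on_sites /=; case: (a x).
- by rewrite /on_sites /=; case: (a x).
- by apply/funext => k; rewrite /on_sites /=; case: (a x).
Qed.

Definition no_final w c c' := forall y, c < y < c' -> ~ final w y.

Definition block w c c' := [/\ final w c, final w c' & no_final w c c'].

(** A gap of length [2 * b] puts the next free hole at distance [2 * b + 1], whence [b.*2.+1]. *)
Fixpoint chain w c (bs : seq nat) : Prop :=
  match bs with
  | [::] => final w c
  | b :: bs' => let c' := c + (b.*2.+1)%:Z in
      [/\ final w c, no_final w c c' & chain w c' bs']
  end.

Lemma chain_final w c bs : chain w c bs -> final w c.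
Proof. by case: bs => // b bs []. Qed.

Lemma chain_agree w w' c bs :
  (forall y, c <= y -> (final w y <-> final w' y)) -> chain w c bs -> chain w' c bs.
Proof.
elim: bs c => [|b bs IH] c e /=; first by move/e; apply.
move=> [fc ng ch]; split; first exact/e.
- by move=> y cy fy; apply: (ng _ cy); apply/e => //; lia.
- by apply: IH ch => y cy; apply: e; lia.
Qed.

(** All sites inspected by the chain are at or to the right of [c], so the left side enters only
    through [c] not being filled from there. *)
Lemma chain_split w c bs : est w c = Hole ->
  (chain w c bs <-> final (restr (< c) w) c /\ chain (restr (> c) w) c bs).
Proof.
move=> hc; have [s1 s2] := final_split hc; split=> [ch|[f1 ch]].
- have fc := chain_final ch; split; first by case/s1: (fc).
  by apply: chain_agree ch; exact: (s2 fc).2.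
- have fc : final w c by apply/s1; split => //; exact: chain_final ch.
  by apply: chain_agree ch => y cy; split; apply (s2 fc).2.
Qed.

(** Renewal step: splitting again at the next free hole [c'] leaves three conditions that read
    disjoint sets of sites, namely [c'], the open interval and the right of [c']. *)
Lemma chain_cons w c b bs : let c' := c + (b.*2.+1)%:Z in
  chain (restr (> c) w) c (b :: bs) <->
  [/\ est w c' = Hole, block (restr (fun x => c < x < c') w) c c' &
      chain (restr (> c') w) c' bs].
Proof.
move=> c'; have cc' : c < c' by rewrite /c'; lia.
pose w1 := restr (> c) w.
have ew1 : est w1 c' = est w c' by rewrite /= /on_sites /= ?inE cc'.
have er1 : restr (< c') w1 = restr (fun x => c < x < c') w.
  by rewrite restr_restr; apply: eq_restr => x /=; rewrite ?inE andbC.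
have er2 : restr (> c') w1 = restr (> c') w.
  rewrite restr_restr; apply: eq_restr => x /=; rewrite ?inE.
  by apply/andP/idP => [[]//|h]; split => //; lia.
(* Given that [c'] stays free, everything up to [c'] is decided inside the interval alone. *)
have blk : est w1 c' = Hole -> final w1 c' ->
   [/\ final w1 c, final w1 c' & no_final w1 c c'] <->
   block (restr (fun x => c < x < c') w) c c'.
  move=> h fc'; have [_ /(_ fc')[e _]] := final_split h; rewrite -er1.
  split=> -[f1 f2 ng]; (split; [by apply/e => //; lia|by apply/e|]) => y cy fy;
    by apply: (ng y cy); apply/e => //; lia.
split=> [/= [fc ng ch]|[hc' bl ch]].
- have fc' := chain_final ch; have hc' := final_hole fc'.
  split; [by rewrite -ew1|by apply/blk|].
  by have /chain_split := hc'; move/(_ bs) => -[/(_ ch)]; rewrite er2 => -[].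
- rewrite -ew1 in hc'.
  have ch1 : chain w1 c' bs.
    by apply/(chain_split bs hc'); rewrite er1 er2; split=> //; case: bl.
  have fc' := chain_final ch1.
  by have [h1 _ h3] := (blk hc' fc').2 bl.
Qed.

End Environment.

(** * The process on a cycle *)

Section Cycle.
Variables (R : realType) (N : nat).
Hypothesis N_gt0 : (0 < N)%N.
Implicit Types (w : env R) (F : set int) (x y z r : int).

Definition cycle_walk w x n : int := (walk (estp w) x n %% N%:Z)%Z.

Definition cycle_sites : seq int := [seq i%:Z | i <- iota 0 N].

Definition cycle_free w : set int :=
  gfires (cycle_walk w) [set y | 0 <= y < N%:Z /\ est w y = Hole]
    (schedule w cycle_sites).

Definition cycle_unique w r :=
  cycle_free w r /\ forall y, 0 <= y < N%:Z -> cycle_free w y -> y = r.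

(** It is the identity off the cycle so that it is injective on all integers, as invariance of the
    law under [reindex] requires. *)
Definition rotate r x : int := if 0 <= x < N%:Z then ((x + r) %% N%:Z)%Z else x.

(** A walk at distance [N] from its start has met every residue class modulo [N]. *)
Definition escapes w x := exists n : nat, N%:Z <= `|walk (estp w) x n - x|.

Let N0 : N%:Z != 0. Proof. by lia. Qed.

Lemma mem_cycle_sites x : (x \in cycle_sites) = (0 <= x < N%:Z).
Proof.
apply/mapP/idP => [[i]|xN]; first by rewrite mem_iota => h ->; lia.
by exists (absz x); [rewrite mem_iota|]; lia.
Qed.

Lemma cycle_sites_uniq : uniq cycle_sites.
Proof. by rewrite map_inj_uniq ?iota_uniq // => i j []. Qed.

Lemma modz_in x : 0 <= (x %% N%:Z)%Z < N%:Z.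
Proof. by rewrite modz_ge0 //= ltz_pmod. Qed.

Lemma modz_id_in x : 0 <= x < N%:Z -> (x %% N%:Z)%Z = x.
Proof. by move=> h; rewrite modz_small //; lia. Qed.

(** Lifting to the universal cover: on the line the walk faces the periodic preimage of [F]. *)
Lemma hits_cycle w F x z : hits (cycle_walk w) F x z <->
  exists y, hits (walk (estp w)) [set y | F (y %% N%:Z)%Z] x y /\ z = (y %% N%:Z)%Z.
Proof.
split=> [[Fz [n [nz hn]]]|[y [[Fy [n [ny hn]]] ->]]].
- exists (walk (estp w) x n); split => //; split; first by rewrite /= -/(cycle_walk w x n) nz.
  by exists n; split => // m mn; exact: hn.
- by split => //; exists n; split => [|m mn]; [rewrite /cycle_walk ny|exact: hn].
Qed.

(* On the cycle of length [N] the two end holes [0] and [N] of the interval are one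
   and the same site. *)
Lemma gfires_cycle w t (F1 F2 : set int) :
  {in t, forall x, 0 < x < N%:Z} -> F1 0 -> F1 N%:Z -> F2 0 ->
  (forall y, 0 < y < N%:Z -> (F1 y <-> F2 y)) ->
  let G1 := gfires (walk (estp w)) F1 t in
  let G2 := gfires (cycle_walk w) F2 t in
  (G1 0 /\ G1 N%:Z <-> G2 0) /\
  (G2 0 -> forall y, 0 < y < N%:Z -> (G1 y <-> G2 y)).
Proof.
elim: t F1 F2 => [|x t IH] F1 F2 tN F10 F1N F20 e //=.
have xN := tN _ (mem_head _ _).
have {}tN : {in t, forall x, 0 < x < N%:Z} by move=> z zt; apply: tN; rewrite inE zt orbT.
(* As long as both ends are free, the walk on the line is confined to the closed interval, where the
   line and the cycle differ only by the identification of the ends. *)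
pose A := [set y : int | 0 <= y <= N%:Z].
have encA : enclosed F1 A.
  move=> y; rewrite /A /= => yA nFy.
  have y0 : y <> 0 by move=> h; rewrite h in nFy.
  have yN : y <> N%:Z by move=> h; rewrite h in nFy.
  by split; lia.
have stay n : (forall m, (m < n)%N -> ~ F1 (walk (estp w) x m)) -> A (walk (estp w) x n).
  by apply: walk_stay => //; rewrite /A /=; lia.
have eA y : A y -> (F1 y <-> F2 (y %% N%:Z)%Z).
  rewrite /A /= => yA.
  have [->|y0] := eqVneq y 0; first by rewrite mod0z.
  have [->|yN] := eqVneq y N%:Z; first by rewrite modzz.
  by rewrite modz_id_in; [apply: e; lia|lia].
have hE := hits_agree stay eA.
have hE2 z : hits (cycle_walk w) F2 x z <->
    exists y, [/\ hits (walk (estp w)) F1 x y, A y & z = (y %% N%:Z)%Z].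
  rewrite hits_cycle; split=> [[y [/hE h ->]]|[y [/hE h _ ->]]]; last by exists y.
  by exists y; split => //; exact: hits_stay h.
(* Site [0] of the cycle is filled exactly when the walk on the line fills one of the two ends. *)
have h0 : hits (cycle_walk w) F2 x 0 <->
    hits (walk (estp w)) F1 x 0 \/ hits (walk (estp w)) F1 x N%:Z.
  rewrite hE2; split=> [[y [hy Ay y0]]|[h|h]].
  - have [yN|yN] := eqVneq y N%:Z; first by right; rewrite -yN.
    have yi : (y %% N%:Z)%Z = y by apply: modz_id_in; move: Ay; rewrite /A /=; lia.
    by left; rewrite y0 yi.
  - by exists 0; split; [by []|rewrite /A /=; lia|rewrite mod0z].
  - by exists N%:Z; split; [by []|rewrite /A /=; lia|rewrite modzz].
have hi y : 0 < y < N%:Z ->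
    (hits (cycle_walk w) F2 x y <-> hits (walk (estp w)) F1 x y).
  move=> yN; rewrite hE2; split=> [[u [hu Au yu]]|h].
  - have uN : u <> N%:Z by move=> uN; move: yu; rewrite uN modzz; lia.
    by move: Au; rewrite /A /= => Au; rewrite yu modz_id_in //; lia.
  - by exists y; split; [by []|rewrite /A /=; lia|rewrite modz_id_in //; lia].
have [hz|hz] := pselect (hits (cycle_walk w) F2 x 0).
  have n2 : ~ gfires (cycle_walk w) (gfire (cycle_walk w) F2 x) t 0.
    by move=> /gfires_sub[_]; apply.
  split; last by move=> /n2.
  split=> [[/gfires_sub[_ a] /gfires_sub[_ b]]|/n2//].
  by case/h0: hz.
apply: IH => //.
- by split => // h; apply: hz; apply/h0; left.
- by split => // h; apply: hz; apply/h0; right.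
- move=> y yN; split=> -[Fy nh]; (split; [exact/(e _ yN)|by move=> /(hi _ yN)]).
Qed.

(** With all active balls in [s], a longer list yields the same schedule, so no limit is left to
    take. *)
Lemma final_holes_after w s : uniq s -> (forall x, active w x -> x \in s) ->
  final w = holes_after w s.
Proof.
move=> us h; apply/funext => y; apply/propext; rewrite finalP; split=> [|fy s' us'].
  exact.
apply: (holes_after_anti us' (undup_uniq (s ++ s'))).
  by move=> z zs; rewrite mem_undup mem_cat zs orbT.
rewrite (_ : holes_after w _ = holes_after w s) // /holes_after; congr gfires.
apply/perm_sortP; [exact: clock_order_total|exact: clock_order_trans|
  exact: clock_order_anti|].
apply: uniq_perm; rewrite ?filter_uniq ?undup_uniq // => x.
rewrite !mem_filter mem_undup mem_cat.
by case: (boolP (active w x)) => //= /h ->.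
Qed.

(** The cycle is cut open at [0]: both ends of the interval survive iff site [0] of the cycle does,
    and then the inner sites have the same fate in both processes. *)
Lemma block_cycle w :
  est w 0 = Hole /\ block (restr (fun x => 0 < x < N%:Z) w) 0 N%:Z <->
  cycle_unique w 0.
Proof.
pose w' := restr (fun x => 0 < x < N%:Z) w.
suff key : est w 0 = Hole -> block w' 0 N%:Z <-> cycle_unique w 0.
  split=> [[/key h] /h //|cu]; have h0 : est w 0 = Hole.
    by have /gfires_sub[] := cu.1.
  by split => //; apply/key.
move=> h0.
have fE : final w' = holes_after w' cycle_sites.
  apply: final_holes_after => //; first exact: cycle_sites_uniq.
  move=> x /andP[/eqP] /=; rewrite /on_sites /= mem_cycle_sites; case: ifP => //.
  by lia.
(* Site [0] is a hole, so every scheduled ball starts strictly inside the interval. *)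
have tE : [seq x <- schedule w cycle_sites | 0 < x < N%:Z] = schedule w cycle_sites.
  apply/all_filterP/allP => x; rewrite mem_schedule mem_cycle_sites.
  move=> /andP[/andP[/eqP xB _] xN]; have : x <> 0 by move=> e; rewrite e h0 in xB.
  by lia.
have tN : {in schedule w cycle_sites, forall x, 0 < x < N%:Z}.
  by move=> x; rewrite -tE mem_filter => /andP[].
have {}fE : final w' = gfires (walk (estp w)) (initial_holes (est w')) (schedule w cycle_sites).
  by rewrite fE holes_after_restr tE.
have i0 : initial_holes (est w') 0 by [].
have iN : initial_holes (est w') N%:Z.
  by rewrite /initial_holes /= /on_sites /=; case: ifP => //; lia.
have c0 : [set y : int | 0 <= y < N%:Z /\ est w y = Hole] 0 by rewrite /=; split => //; lia.
have [] := gfires_cycle w tN i0 iN c0.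
  move=> y yN; rewrite /initial_holes /= /on_sites /= yN.
  by split=> [|[]//]; split => //; lia.
rewrite -fE -/(cycle_free w) => k1 k2; split=> [[b0 bN bi]|[c1 ci]].
- have cf : cycle_free w 0 by apply/k1.
  split => // y yN cy; have [//|y0] := eqVneq y 0.
  by case: (bi y); [lia|apply/k2 => //; lia].
- have [b0 bN] := k1.2 c1; split => // y yN /(k2 c1 _ yN) /ci; lia.
Qed.

(** Discrete intermediate value property of a walk with unit steps. *)
Lemma walk_between (stp : int -> nat -> bool) x n v :
  (x <= v <= walk stp x n) || (walk stp x n <= v <= x) ->
  exists m, walk stp x m = v.
Proof.
elim: n => [|n IH]; first by rewrite walk0 => h; exists 0%N; rewrite walk0; lia.
rewrite walkS => h.
have [hn|hn] := boolP ((x <= v <= walk stp x n) || (walk stp x n <= v <= x)).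
  exact: IH.
by exists n.+1; rewrite walkS; case: ifP h => _ h; lia.
Qed.

Lemma hits_cycle_ex w F x y : escapes w x -> 0 <= y < N%:Z -> F y ->
  exists z, hits (cycle_walk w) F x z.
Proof.
move=> esc yN Fy; have [n hn] := esc.
have d1 := modz_in (y - x); have d2 := modz_in (x - y).
have [m] : exists m, (walk (estp w) x m %% N%:Z)%Z = y; last first.
  by move=> hm; apply: (@hitsP _ F x m); rewrite /cycle_walk hm.
(* The target is the representative of [y] modulo [N] closest to [x] on the side to which the walk
   escapes; it is less than [N] away. *)
have [up|down] := leP x (walk (estp w) x n).
- have [|m hm] := @walk_between (estp w) x n (x + ((y - x) %% N%:Z)%Z).
    by apply/orP; left; lia.
  by exists m; rewrite hm modzDmr addrC subrK modz_id_in.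
- have [|m hm] := @walk_between (estp w) x n (x - ((x - y) %% N%:Z)%Z).
    by apply/orP; right; lia.
  exists m; rewrite hm {1}(divz_eq (x - y) N%:Z) -[RHS]modz_id_in //.
  apply/eqP; rewrite eqz_mod_dvd; apply/dvdzP; exists ((x - y) %/ N%:Z)%Z.
  have := divz_eq (x - y) N%:Z.
  set q := (_ %/ _)%Z; set u := (_ %% _)%Z; move=> e.
  rewrite -e -/u; lia.
Qed.

Definition cycle_count F : nat := count (fun y => `[< F y >]) cycle_sites.

(** An escaping walk meets some free hole if one exists and fills only the first; the truncated
    predecessor covers the case of no hole left. *)
Lemma cycle_count_fire w F x : F `<=` [set y | 0 <= y < N%:Z] -> escapes w x ->
  cycle_count (gfire (cycle_walk w) F x) = (cycle_count F).-1.
Proof.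
move=> FN esc.
have [[y Fy]|nF] := pselect (exists y, F y); last first.
  have c0 G : G `<=` F -> cycle_count G = 0%N.
    move=> GF; apply/eqP; rewrite -leqn0 leqNgt -has_count; apply/hasP => -[y _ /asboolP Gy].
    by apply: nF; exists y; apply: GF.
  by rewrite !c0 //; exact: gfire_sub.
have [z hz] := hits_cycle_ex esc (FN _ Fy) Fy.
have zs : z \in [seq y <- cycle_sites | `[< F y >]].
  rewrite mem_filter mem_cycle_sites; apply/andP; split; last by apply: FN; case: hz.
  by apply/asboolP; case: hz.
rewrite /cycle_count -!size_filter -(size_rem zs) rem_filter; last first.
  by rewrite filter_uniq // cycle_sites_uniq.
rewrite -filter_predI; congr size; apply: eq_filter => u /=.
apply/asboolP/andP => [[Fu nh]|[uz /asboolP Fu]].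
  by split; [apply/eqP => uz; apply: nh; rewrite uz|apply/asboolP].
by split => // /(hits_unique hz) zu; rewrite zu eqxx in uz.
Qed.

Lemma cycle_count_fires w F t : F `<=` [set y | 0 <= y < N%:Z] ->
  {in t, forall x, escapes w x} ->
  cycle_count (gfires (cycle_walk w) F t) = (cycle_count F - size t)%N.
Proof.
elim: t F => [|x t IH] F FN esc /=; first by rewrite subn0.
rewrite IH.
- by rewrite cycle_count_fire //; [rewrite subnS predn_sub|apply: esc; rewrite mem_head].
- exact: subset_trans (@gfire_sub _ _ _) FN.
- by move=> z zt; apply: esc; rewrite inE zt orbT.
Qed.

Lemma cycle_uniqueP w : (exists2 r, 0 <= r < N%:Z & cycle_unique w r) <->
  cycle_count (cycle_free w) = 1%N.
Proof.
have sub : cycle_free w `<=` [set y | 0 <= y < N%:Z] by move=> y /gfires_sub[].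
split=> [[r rN [cr ur]]|].
  rewrite /cycle_count (@eq_in_count _ _ (pred1 r)); last first.
    move=> y; rewrite mem_cycle_sites => yN /=.
    by apply/asboolP/eqP => [|->]//; exact: ur.
  by rewrite count_uniq_mem ?cycle_sites_uniq // mem_cycle_sites rN.
rewrite /cycle_count -size_filter.
case E : [seq _ <- _ | _] => [|r [|]] //= _.
have memE y : (y \in [:: r]) = `[< cycle_free w y >] && (0 <= y < N%:Z).
  by rewrite -E mem_filter mem_cycle_sites.
have := memE r; rewrite mem_head => /esym /andP[/asboolP cr rN].
exists r => //; split => // y yN cy; apply/eqP; rewrite -mem_seq1 memE yN andbT.
exact/asboolP.
Qed.

(** With [k] balls there are [2 * b + 1 - k] holes, of which [k] get filled, and
    [2 * b + 1 - 2 * k = 1] means [k = b]. Neither the order of firing nor the trajectories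
    matter. *)
Lemma cycle_unique_balls w b : N = b.*2.+1 ->
  {in cycle_sites, forall x, [/\ escapes w x, eclk w x <= 1 & est w x <> Neutral]} ->
  (exists2 r, 0 <= r < N%:Z & cycle_unique w r) <->
  count (fun x => est w x == Ball) cycle_sites = b.
Proof.
move=> Nb good; rewrite cycle_uniqueP cycle_count_fires; last 2 first.
- by move=> y [].
- by move=> x; rewrite mem_schedule => /andP[_ /good[]].
have -> : cycle_count [set y | 0 <= y < N%:Z /\ est w y = Hole] =
    count (predC (fun x => est w x == Ball)) cycle_sites.
  apply: eq_in_count => x xs /=; have [_ _ nN] := good _ xs.
  rewrite mem_cycle_sites in xs; apply/asboolP/negP => [[_ ->]//|].
  by move=> nB; split => //; case: (est w x) nB nN.
have -> : size (schedule w cycle_sites) = count (fun x => est w x == Ball) cycle_sites.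
  rewrite size_sort size_filter; apply: eq_in_count => x xs /=.
  by have [_ c1 _] := good _ xs; rewrite /active c1 andbT.
have := count_predC (fun x => est w x == Ball) cycle_sites.
rewrite size_map size_iota Nb; lia.
Qed.

Lemma rotate_in r x : 0 <= x < N%:Z -> 0 <= rotate r x < N%:Z.
Proof. by move=> xN; rewrite /rotate xN modz_in. Qed.

Lemma rotate_inj r : injective (rotate r).
Proof.
move=> x y; rewrite /rotate; case: ifP => xN; case: ifP => yN //.
- move=> /eqP; rewrite eqz_modDr => /eqP; rewrite !modz_id_in //.
- by move=> e; have := modz_in (x + r); rewrite e yN.
- by move=> e; have := modz_in (y + r); rewrite -e xN.
Qed.

(** Ties are broken by position, which a rotation does not respect; this is why distinct clocks are
    assumed. *)
Lemma cycle_free_rotate w r y :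
  {in cycle_sites &, forall x x', eclk w x = eclk w x' -> x = x'} ->
  0 <= y < N%:Z ->
  cycle_free (reindex (rotate r) w) y <-> cycle_free w (rotate r y).
Proof.
move=> noties yN; rewrite /cycle_free.
have -> : schedule w cycle_sites =
    [seq rotate r x | x <- schedule (reindex (rotate r) w) cycle_sites].
  rewrite (@schedule_perm _ w _ [seq rotate r x | x <- cycle_sites]); last first.
    have uN : uniq [seq rotate r x | x <- cycle_sites].
      by rewrite map_inj_uniq ?cycle_sites_uniq //; exact: rotate_inj.
    rewrite perm_sym; apply: uniq_perm => //; first exact: cycle_sites_uniq.
    suff sub : {subset [seq rotate r x | x <- cycle_sites] <= cycle_sites}.
      by have [|_] := uniq_min_size uN sub; rewrite ?size_map.
    by move=> _ /mapP[x xs ->]; move: xs; rewrite !mem_cycle_sites; exact: rotate_in.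
  rewrite /schedule filter_map sort_map; congr map; apply/esym/eq_sort_clock.
    by move=> u v; exact: clock_order_total.
  move=> u v; rewrite !mem_filter => /andP[_ us] /andP[_ vs].
  rewrite /clock_order /=; case: (ltgtP (eclk w _) (eclk w _)) => //= e.
  have e' := noties _ _ _ _ e; rewrite !mem_cycle_sites in us vs e'.
  by rewrite (rotate_inj (e' (rotate_in _ us) (rotate_in _ vs))) !lexx.
apply: (@gfires_relabel _ _ _ [set y | 0 <= y < N%:Z]) => //.
- by move=> x; rewrite mem_schedule mem_cycle_sites => /andP[].
- by move=> x n _; exact: modz_in.
- move=> x n /= xN; rewrite [RHS]/rotate modz_in /cycle_walk /walk.
  rewrite [rotate r x]/rotate xN; apply/eqP; rewrite modzDml modzDml.
  rewrite addrAC; apply/eqP; congr (((_ + _) + _) %% _)%Z.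
  by apply: eq_bigr => k _; rewrite /= /rotate xN.
- by move=> u v _ _; exact: rotate_inj.
- by move=> u /= uN; split=> -[h1 h2]; split => //; exact: rotate_in.
Qed.

(** Turns the event that [r] survives alone into the event for [0] in a rotated environment, so that
    all sites become equally likely. *)
Lemma cycle_unique_rotate w r :
  {in cycle_sites &, forall x x', eclk w x = eclk w x' -> x = x'} ->
  0 <= r < N%:Z ->
  cycle_unique (reindex (rotate r) w) 0 <-> cycle_unique w r.
Proof.
move=> noties rN.
have z0 : (0 : int) <= 0 < N%:Z by rewrite lexx ltz_nat.
have r0 : rotate r 0 = r by rewrite /rotate z0 add0r modz_id_in.
split=> -[f0 u0]; split.
- by have /cycle_free_rotate := f0; rewrite r0; apply.
- move=> y yN fy; pose x := ((y - r) %% N%:Z)%Z.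
  have xN : 0 <= x < N%:Z by exact: modz_in.
  have xy : rotate r x = y by rewrite /rotate xN modzDml subrK modz_id_in.
  have x0 : x = 0 by apply: u0 => //; apply/cycle_free_rotate => //; rewrite xy.
  by rewrite -xy x0.
- by apply/cycle_free_rotate => //; rewrite r0.
- move=> y yN /(cycle_free_rotate _ noties yN) fy; apply: (@rotate_inj r).
  by rewrite r0; apply: u0 => //; exact: rotate_in.
Qed.

End Cycle.

(** * The law of the environment *)

Section EnvMeasurable.
Variable R : realType.

HB.instance Definition _ := gen_eqMixin (env R).
HB.instance Definition _ := gen_choiceMixin (env R).
HB.instance Definition _ := isPointed.Build (env R)
  (Env (fun=> Hole) (fun=> 0) (fun _ _ => false)).

Definition coord (i : golf_index) (w : env R) : R :=
  match i with
  | inl (inl x) => site_to_R (est w x)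
  | inl (inr x) => eclk w x
  | inr (x, k) => if estp w x k then 1 else 0
  end.

Implicit Types (s : seq golf_index) (t : golf_index -> \bar R).

(** Thresholds are extended reals so that [+oo] means no constraint and [-oo] an impossible one.
    Cylinders over different lists can then be written over a common list. *)
Definition cylinder s t : set (env R) :=
  [set w | forall i, i \in s -> ((coord i w)%:E <= t i)%E].

Definition cylinders : set (set (env R)) :=
  [set C | exists s t, uniq s /\ C = cylinder s t].

Definition env_space := g_sigma_algebraType cylinders.

Definition extend s t : golf_index -> \bar R := fun i => if i \in s then t i else +oo%E.

Lemma cylinder_extend s t s' : {subset s <= s'} -> cylinder s t = cylinder s' (extend s t).
Proof.
move=> ss; apply/seteqP; split=> w h i.
- by move=> _; rewrite /extend; case: ifP => [/h//|_]; rewrite leey.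
- by move=> is_; have := h i (ss _ is_); rewrite /extend is_.
Qed.

Lemma cylinderI s t t' :
  cylinder s t `&` cylinder s t' = cylinder s (fun i => Order.min (t i) (t' i)).
Proof.
apply/seteqP; split=> w.
- by move=> [h h'] i is_; rewrite le_min h // h'.
- by move=> h; split=> i /h; rewrite le_min => /andP[].
Qed.

Lemma cylinders_setI : setI_closed cylinders.
Proof.
move=> _ _ [s [t [us ->]]] [s' [t' [us' ->]]].
pose u := undup (s ++ s').
have su : {subset s <= u} by move=> x; rewrite mem_undup mem_cat => ->.
have su' : {subset s' <= u} by move=> x; rewrite mem_undup mem_cat orbC => ->.
exists u, (fun i => Order.min (extend s t i) (extend s' t' i)); split; first exact: undup_uniq.
by rewrite (cylinder_extend t su) (cylinder_extend t' su') cylinderI.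
Qed.

Lemma cylinder_nil t : cylinder [::] t = setT.
Proof. by apply/seteqP; split. Qed.

Lemma measurable_cylinder s t : uniq s -> measurable (cylinder s t : set env_space).
Proof. by move=> us; apply: sub_sigma_algebra; exists s, t. Qed.

Lemma env_measure_unique (m1 m2 : {measure set env_space -> \bar R}) :
  (m1 setT < +oo)%E ->
  (forall s t, uniq s -> m1 (cylinder s t) = m2 (cylinder s t)) ->
  forall A, measurable A -> m1 A = m2 A.
Proof.
move=> fin e A mA.
apply: (@measure_unique _ R env_space cylinders (fun=> setT)) => //.
- exact: cylinders_setI.
- by move=> _; exists [::], (fun=> +oo%E); rewrite cylinder_nil.
- by rewrite bigcup_const.
- by move=> _ [s [t [us ->]]]; exact: e.
Qed.

Lemma measurable_env d (T : measurableType d) (f : T -> env_space) :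
  (forall s t, uniq s -> measurable (f @^-1` cylinder s t)) ->
  measurable_fun setT f.
Proof.
move=> h; apply: (@measurability _ _ T env_space setT f cylinders) => //.
by move=> _ [_ [s [t [us ->]]] <-]; rewrite setTI; exact: h.
Qed.

(** For fixed [C] the sets [A] satisfying the product formula form a Dynkin class, so cylinders
    suffice. Used once for each of two factors, this yields full independence. *)
Lemma env_dynkin d (T : measurableType d) (P : probability T R) (f : T -> env_space)
  (C : set T) :
  measurable_fun setT f -> measurable C ->
  (forall s t, uniq s ->
    P (f @^-1` cylinder s t `&` C) = (P (f @^-1` cylinder s t) * P C)%E) ->
  forall A, measurable A -> P (f @^-1` A `&` C) = (P (f @^-1` A) * P C)%E.
Proof.
move=> mf mC h.
have mpre A : measurable A -> measurable (f @^-1` A).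
  by move=> mA; rewrite -[X in measurable X]setTI; exact: mf.
apply: (@dynkin_induction _ env_space cylinders) => //.
- exact: cylinders_setI.
- by rewrite preimage_setT setTI probability_setT mul1e.
- by move=> _ [s [t [us ->]]]; exact: h.
- move=> A mA IH.
  have mfA := mpre _ mA.
  have -> : f @^-1` (~` A) = ~` (f @^-1` A) by [].
  have D : P (C `\` f @^-1` A) = (P C - P (C `&` f @^-1` A))%E.
    by apply: measureD => //; rewrite ltey_eq fin_num_measure.
  rewrite setIC -setDE D setIC IH probability_setC //.
  rewrite -[P C]fineK ?fin_num_measure // -[P (f @^-1` A)]fineK ?fin_num_measure //.
  by rewrite -EFinM -!EFinB -EFinM mulrBl mul1r.
- move=> F mF tF IH.
  have tfF : trivIset setT (fun n => f @^-1` F n).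
    apply/trivIsetP => i j _ _ ij; rewrite -preimage_setI.
    by move/trivIsetP : tF => /(_ _ _ _ _ ij) ->//; rewrite preimage_set0.
  rewrite preimage_bigcup setI_bigcupl !measure_bigcup //; last 3 first.
  + by move=> n _; exact: mpre.
  + by move=> n _; apply: measurableI => //; exact: mpre.
  + apply/trivIsetP => i j _ _ ij; rewrite setIACA setIid.
    by move/trivIsetP : tfF => /(_ _ _ _ _ ij) ->//; rewrite set0I.
  rewrite -[P C]fineK ?fin_num_measure // muleC -nneseriesZl //.
  by apply: eq_eseriesr => n _; rewrite fineK ?fin_num_measure // muleC; exact: IH.
Qed.

End EnvMeasurable.

(** * The product law: invariance under relabelling, and independence over disjoint sets of
    coordinates *)

Section Law.
Variables (R : realType) (rb p : R).
Implicit Types (s : seq golf_index) (t : golf_index -> \bar R) (D : pred golf_index).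

(** Distribution functions under the encoding [Ball = 0], [Hole = 1], and [1] or [0] for a step to
    the right or left. Neutral sites have mass zero, since [rb + rh = 1], so the first one reaches
    [1] at [r = 1]. *)
Definition cdf_at (i : golf_index) (r : R) : R :=
  match i with
  | inl (inl _) => if r < 0 then 0 else if r < 1 then rb else 1
  | inl (inr _) => if r < 0 then 0 else if r <= 1 then r else 1
  | inr _ => if r < 0 then 0 else if r < 1 then 1 - p else 1
  end.

Definition cdf (i : golf_index) (t : \bar R) : R :=
  match t with
  | EFin r => cdf_at i r
  | EPInf => 1
  | ENInf => 0
  end.

Definition golf_law (mu : set (env_space R) -> \bar R) :=
  forall s t, uniq s -> mu (cylinder s t) = (\prod_(i <- s) cdf i (t i))%:E.

Lemma prod_cdf_extend s t u : uniq s -> uniq u -> {subset s <= u} ->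
  \prod_(i <- s) cdf i (t i) = \prod_(i <- u) cdf i (extend s t i).
Proof.
move=> us uu su; rewrite [RHS](bigID (mem s)) /= [X in _ = _ * X]big1 ?mulr1; last first.
  by move=> i /negbTE nis; rewrite /extend nis.
rewrite -[RHS]big_filter (perm_big [seq i <- u | i \in s]) /=; last first.
  apply: uniq_perm => //; first exact: filter_uniq.
  by move=> i; rewrite mem_filter; case: (boolP (i \in s)) => // /su ->.
by rewrite !big_filter; apply: eq_bigr => i is_; rewrite /extend is_.
Qed.

Definition reindex_index (f : int -> int) (i : golf_index) : golf_index :=
  match i with
  | inl (inl x) => inl (inl (f x))
  | inl (inr x) => inl (inr (f x))
  | inr (x, k) => inr (f x, k)
  end.

Lemma reindex_index_inj f : injective f -> injective (reindex_index f).
Proof. by move=> fi [[x|x]|[x k]] [[y|y]|[y l]] //= [/fi ->] // ->. Qed.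

Lemma coord_reindex f i (w : env R) : coord i (reindex f w) = coord (reindex_index f i) w.
Proof. by case: i => [[]|[]]. Qed.

Lemma cdf_reindex f i : cdf (reindex_index f i) =1 cdf i.
Proof. by case: i => [[]|[]] //= *; case. Qed.

(** The threshold at [reindex_index f i] is [t i]; looking it up by position in the list avoids an
    inverse of [f]. *)
Definition transport (f : int -> int) s t : golf_index -> \bar R :=
  fun j => nth +oo%E [seq t i | i <- s] (index j [seq reindex_index f i | i <- s]).

Lemma preimage_reindex f s t : injective f ->
  reindex f @^-1` cylinder s t = cylinder [seq reindex_index f i | i <- s] (transport f s t).
Proof.
move=> /reindex_index_inj fi.
have tE i : i \in s -> transport f s t (reindex_index f i) = t i.
  move=> is_; rewrite /transport index_map //.
  by rewrite (nth_map i) ?index_mem // nth_index.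
apply/seteqP; split=> w h i.
- by move=> /mapP[j js ->]; rewrite tE // -coord_reindex; exact: h.
- by move=> is_; have := h _ (map_f _ is_); rewrite tE // coord_reindex.
Qed.

Lemma measurable_reindex f : injective f ->
  measurable_fun setT (reindex f : env_space R -> env_space R).
Proof.
move=> fi; apply: measurable_env => s t us; rewrite preimage_reindex //.
by apply: measurable_cylinder; rewrite map_inj_uniq //; exact: reindex_index_inj.
Qed.

Lemma coord_restrict D i (w : env R) :
  coord i (restrict D w) = if D i then coord i w else coord i (restrict pred0 w).
Proof. by case: i => [[x|x]|[x k]] /=; case: (D _). Qed.

(* Coordinates outside [D] are constant after [restrict D], so that a constraint
   on them becomes void or impossible. *)
Definition cut D t : golf_index -> \bar R := fun i =>
  if D i then t i
  else if ((coord i (restrict pred0 point))%:E <= t i)%E then +oo%E else -oo%E.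

Lemma preimage_restrict D s t : restrict D @^-1` cylinder s t = cylinder s (cut D t).
Proof.
have c0 i (w : env R) : coord i (restrict pred0 w) = coord i (restrict pred0 point).
  by case: i => [[]|[]].
apply/seteqP; split=> w h i /[dup] is_ /h; rewrite coord_restrict /cut c0;
by case: (D i) => //; case: ifP => // _; rewrite leey.
Qed.

Lemma measurable_restrict D :
  measurable_fun setT (restrict D : env_space R -> env_space R).
Proof.
move=> *; apply: measurable_env => // s t us; rewrite preimage_restrict.
exact: measurable_cylinder.
Qed.

Lemma measurable_preimage (f : env_space R -> env_space R) (A : set (env_space R)) :
  measurable_fun setT f -> measurable A -> measurable (f @^-1` A).
Proof. by move=> mf mA; rewrite -[X in measurable X]setTI; exact: mf. Qed.

Variable mu : probability (env_space R) R.
Hypothesis mu_law : golf_law mu.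

(** The coordinates are independent with a law depending only on their kind (site, clock or step),
    so renaming sites injectively preserves all cylinder probabilities. Translations and rotations
    are the cases used. *)
Lemma law_reindex f (A : set (env_space R)) : injective f -> measurable A ->
  mu (reindex f @^-1` A) = mu A.
Proof.
move=> fi mA.
pose X : {mfun env_space R >-> env_space R} := HB.pack (reindex f : env_space R -> env_space R)
  (isMeasurableFun.Build _ _ _ _ (reindex f : env_space R -> env_space R) (measurable_reindex fi)).
apply: (@env_measure_unique R (distribution mu X) mu) => //.
- by rewrite /= /distribution /pushforward /= preimage_setT probability_setT ltry.
- move=> s t us; rewrite /= /distribution /pushforward /= preimage_reindex // mu_law; last first.
    by rewrite map_inj_uniq //; exact: reindex_index_inj.
  rewrite mu_law // big_map; congr (_%:E).
  rewrite big_seq [RHS]big_seq; apply: eq_bigr => i is_; rewrite cdf_reindex.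
  rewrite /transport index_map; last exact: reindex_index_inj.
  by rewrite (nth_map i) ?index_mem // nth_index.
Qed.

(** At each coordinate at least one of the two cut thresholds is infinite, and a minimum with [+oo]
    or [-oo] multiplies the distribution function by [1] or [0]. *)
Lemma law_cylinderI D1 D2 s1 s2 t1 t2 : (forall i, D1 i -> ~~ D2 i) ->
  uniq s1 -> uniq s2 ->
  mu (cylinder s1 (cut D1 t1) `&` cylinder s2 (cut D2 t2)) =
  (mu (cylinder s1 (cut D1 t1)) * mu (cylinder s2 (cut D2 t2)))%E.
Proof.
move=> dis us1 us2.
pose u := undup (s1 ++ s2).
have su1 : {subset s1 <= u} by move=> x; rewrite mem_undup mem_cat => ->.
have su2 : {subset s2 <= u} by move=> x; rewrite mem_undup mem_cat orbC => ->.
have uu : uniq u by exact: undup_uniq.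
rewrite (mu_law _ us1) (mu_law _ us2).
rewrite (prod_cdf_extend _ us1 uu su1) (prod_cdf_extend _ us2 uu su2).
rewrite (cylinder_extend _ su1) (cylinder_extend _ su2) cylinderI mu_law //.
rewrite -EFinM -big_split /=; congr (_%:E); apply: eq_bigr => i _.
have cpoo (x : \bar R) : cdf i (Order.min +oo%E x) = 1 * cdf i x.
  by rewrite mul1r min_r // leey.
have cnoo (x : \bar R) : cdf i (Order.min -oo%E x) = 0 * cdf i x.
  by rewrite mul0r min_l // leNye.
have [n1|n2] : ~~ D1 i \/ ~~ D2 i.
- by case: (boolP (D1 i)) => [/dis|]; [right|left].
- rewrite {1 3}/extend /cut (negbTE n1).
  by case: ifP => _; [case: ifP => _|].
- rewrite minC mulrC {1 3}/extend /cut (negbTE n2).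
  by case: ifP => _; [case: ifP => _|].
Qed.

Lemma law_indep D1 D2 (A B : set (env_space R)) : (forall i, D1 i -> ~~ D2 i) ->
  measurable A -> measurable B ->
  mu (restrict D1 @^-1` A `&` restrict D2 @^-1` B) =
  (mu (restrict D1 @^-1` A) * mu (restrict D2 @^-1` B))%E.
Proof.
move=> dis mA mB.
have m2 := measurable_preimage (measurable_restrict D2) mB.
apply: (@env_dynkin R _ (env_space R) mu (restrict D1)) => // [|s1 t1 us1].
  exact: measurable_restrict.
rewrite setIC muleC.
have m1 : measurable (restrict D1 @^-1` cylinder s1 t1 : set (env_space R)).
  by apply: measurable_preimage; [exact: measurable_restrict|exact: measurable_cylinder].
apply: (@env_dynkin R _ (env_space R) mu (restrict D2)) => // [|s2 t2 us2].
  exact: measurable_restrict.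
rewrite !preimage_restrict setIC muleC; exact: law_cylinderI.
Qed.

End Law.

(** * From the given probability space to the law of the environment *)

Section Transfer.
Variables (d : measure_display) (T : measurableType d) (R : realType).
Variables (P : probability T R) (rb rh p : R).
Variables (st : int -> T -> site) (clk : int -> T -> R) (stp : int -> nat -> T -> bool).
Hypotheses (rbh : rb + rh = 1) (golf : golf_randomness P rb rh p st clk stp).

Definition env_of (w : T) : env_space R :=
  Env (fun x => st x w) (fun x => clk x w) (fun x k => stp x k w).

Lemma coord_env_of i w : coord i (env_of w) = golf_rv st clk stp i w.
Proof. by case: i => [[x|x]|[x k]]. Qed.

Definition below (t : \bar R) : set R := [set x | (x%:E <= t)%E].

Lemma measurable_below t : measurable (below t).
Proof.
case: t => [r| |].
- by rewrite (_ : below _ = `]-oo, r]%classic) //; apply/seteqP; split=> x /=;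
    rewrite /below /= lee_fin in_itv.
- by rewrite (_ : below _ = setT) //; apply/seteqP; split=> x //= _; rewrite /below /= leey.
- by rewrite (_ : below _ = set0) //; apply/seteqP; split=> x //=.
Qed.

Lemma preimage_env_of s t : env_of @^-1` cylinder s t =
  \bigcap_(i in [set` s]) (golf_rv st clk stp i @^-1` below (t i)).
Proof.
apply/seteqP; split=> w h i /= is_; first by rewrite /below /= -coord_env_of; exact: h.
by rewrite coord_env_of; exact: (h i is_).
Qed.

Let mrv i B : measurable B -> measurable (golf_rv st clk stp i @^-1` B).
Proof.
by move=> mB; rewrite -[X in measurable X]setTI; case: golf => -[/(_ i) h _] _ _ _; exact: h.
Qed.

Lemma measurable_env_of : measurable_fun setT env_of.
Proof.
apply: measurable_env => s t us; rewrite preimage_env_of.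
apply: fin_bigcap_measurable; first exact: finite_seq.
by move=> i _; apply: mrv; exact: measurable_below.
Qed.

Lemma golf_rv_cdf i t : P (golf_rv st clk stp i @^-1` below t) = (cdf rb p i t)%:E.
Proof.
case: t => [r| |]; last 2 first.
- rewrite (_ : _ @^-1` _ = setT) ?probability_setT //.
  by apply/seteqP; split=> x //= _; rewrite /below /= leey.
- by rewrite (_ : _ @^-1` _ = set0) ?measure0 //; apply/seteqP; split=> x.
have mB := mrv i (measurable_below r%:E).
(* Thresholds beyond the values covered by the hypotheses are settled by comparison with an event of
   probability one or zero. *)
have P1 A B : measurable A -> measurable B -> A `<=` B -> P A = 1%E -> P B = 1%E.
  move=> mA mB' AB PA; apply/eqP; rewrite eq_le probability_le1 //=.
  by rewrite -PA; apply: le_measure => //; rewrite inE.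
have P0 A B : measurable A -> measurable B -> A `<=` B -> P B = 0%E -> P A = 0%E.
  move=> mA mB' AB PB; apply/eqP; rewrite eq_le measure_ge0 andbT.
  by rewrite -PB; apply: le_measure => //; rewrite inE.
have [_ hst hclk hstp] := golf.
case: i mB => [[x|x]|[x k]] mB /=.
- have mS v : measurable [set w | st x w = v].
    rewrite (_ : [set _ | _] = golf_rv st clk stp (inl (inl x)) @^-1` [set site_to_R v]).
      exact: mrv.
    apply/seteqP; split=> w /=; first by move=> ->.
    by rewrite /site_to_R => /eqP; rewrite eqr_nat => /eqP /(can_inj site_codeK).
  have [hB [hH _]] := hst x.
  case: ltP => r0.
    rewrite (_ : _ @^-1` _ = set0) ?measure0 //; apply/seteqP; split=> w //=.
    rewrite /below /= lee_fin => h; have := le_lt_trans h r0.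
    by rewrite ltNge /site_to_R ler0n.
  case: ltP => r1.
    rewrite (_ : _ @^-1` _ = [set w | st x w = Ball]) //; apply/seteqP; split=> w /=.
      rewrite /below /= lee_fin => h; have := le_lt_trans h r1.
      by case: (st x w) => //; rewrite ltNge /site_to_R ler1n.
    by move=> ->; rewrite /below /= lee_fin.
  apply: (P1 ([set w | st x w = Ball] `|` [set w | st x w = Hole])).
  + exact: measurableU.
  + exact: mB.
  + by move=> w [] /= ->; rewrite /below /= lee_fin // (le_trans _ r1).
  + rewrite measureU //; last by apply/seteqP; split=> w //= -[->].
    by rewrite [X in (X + _)%E]hB [X in (_ + X)%E]hH -EFinD rbh.
- have mC (u : R) : measurable [set w | clk x w <= u].
    exact: (mrv (inl (inr x)) (measurable_below u%:E)).
  case: ltP => r0.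
    apply: (P0 _ [set w | clk x w <= 0]) => //; last by rewrite hclk // lexx ler01.
    by move=> w /=; rewrite /below /= lee_fin => h; exact: le_trans h (ltW r0).
  case: leP => r1; first by apply: (hclk x r); rewrite r0.
  apply: (P1 [set w | clk x w <= 1]) => //; last by rewrite hclk // lexx ler01.
  by move=> w /=; rewrite /below /= lee_fin => h; exact: le_trans h (ltW r1).
- have mS : measurable [set w | stp x k w].
    rewrite (_ : [set _ | _] = golf_rv st clk stp (inr (x, k)) @^-1` [set 1]).
      exact: mrv.
    apply/seteqP; split=> w /=; first by move=> ->.
    by case: (stp x k w) => // /eqP; rewrite eq_sym oner_eq0.
  case: ltP => r0.
    rewrite (_ : _ @^-1` _ = set0) ?measure0 //; apply/seteqP; split=> w //=.
    rewrite /below /= lee_fin => h; have := le_lt_trans h r0.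
    by case: ifP; rewrite ?ltxx ?ltr10.
  case: ltP => r1.
    rewrite (_ : _ @^-1` _ = ~` [set w | stp x k w]).
      by rewrite probability_setC // hstp EFinB.
    apply/seteqP; split=> w /=; rewrite /below /= lee_fin.
      by case: (stp x k w) => // h; have := le_lt_trans h r1; rewrite ltxx.
    by case: (stp x k w).
  rewrite (_ : _ @^-1` _ = setT) ?probability_setT //; apply/seteqP; split=> w //= _.
  by rewrite /below /= lee_fin; case: ifP.
Qed.

Lemma golf_transfer : exists2 mu : probability (env_space R) R, golf_law rb p mu &
  forall A, measurable A -> P (env_of @^-1` A) = mu A.
Proof.
pose X : {mfun T >-> env_space R} :=
  HB.pack env_of (isMeasurableFun.Build _ _ _ _ env_of measurable_env_of).
exists (distribution P X) => // s t us.
rewrite /= /distribution /pushforward /= preimage_env_of.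
have [[_ ind] _ _ _] := golf.
rewrite -[LHS]fineK; last first.
  apply: fin_num_measure; apply: fin_bigcap_measurable; first exact: finite_seq.
  by move=> i _; apply: mrv; exact: measurable_below.
rewrite ind //; last by move=> i; exact: measurable_below.
by congr (_%:E); apply: eq_bigr => i _; rewrite golf_rv_cdf.
Qed.

End Transfer.

(** * Measurability *)

Section Events.
Variable R : realType.
Implicit Types (Q : env R -> Prop) (x y z : int) (s t : seq int).

(** Stating measurability for predicates lets its proofs follow the logical structure: connectives
    and countable quantifiers over coordinate inequalities. *)
Definition event Q := measurable ([set w | Q w] : set (env_space R)).

Lemma eq_event Q Q' : (forall w, Q w <-> Q' w) -> event Q' -> event Q.
Proof.
move=> e; rewrite /event (_ : [set w | Q w] = [set w | Q' w]) //.
by apply/seteqP; split=> w /= /e.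
Qed.

Lemma event_const (A : Prop) : event (fun=> A).
Proof.
have [a|na] := pselect A.
  by rewrite /event (_ : [set w | A] = setT) //; apply/seteqP; split.
by rewrite /event (_ : [set w | A] = set0) //; apply/seteqP; split.
Qed.

Lemma event_and Q Q' : event Q -> event Q' -> event (fun w => Q w /\ Q' w).
Proof. exact: measurableI. Qed.

Lemma event_or Q Q' : event Q -> event Q' -> event (fun w => Q w \/ Q' w).
Proof. exact: measurableU. Qed.

Lemma event_not Q : event Q -> event (fun w => ~ Q w).
Proof. exact: measurableC. Qed.

Lemma event_imp Q Q' : event Q -> event Q' -> event (fun w => Q w -> Q' w).
Proof.
move=> eQ eQ'; apply: (@eq_event _ (fun w => ~ Q w \/ Q' w)); last first.
  exact: event_or (event_not eQ) eQ'.
move=> w; split=> [h|[nq|//] /nq//].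
by have [/h|] := pselect (Q w); [right|left].
Qed.

Lemma event_exists (I : countType) (Q : I -> env R -> Prop) :
  (forall i, event (Q i)) -> event (fun w => exists i, Q i w).
Proof.
move=> eQ; pose F n : set (env_space R) :=
  if unpickle n is Some i then [set w | Q i w] else set0.
rewrite /event (_ : [set w | _] = \bigcup_n F n).
  by apply: bigcupT_measurable => n; rewrite /F; case: unpickle => // i; exact: eQ.
apply/seteqP; split=> w /= [i].
- by move=> Qi; exists (pickle i) => //; rewrite /F pickleK.
- by rewrite /F => _; case: unpickle => // j Qj; exists j.
Qed.

Lemma event_forall (I : countType) (Q : I -> env R -> Prop) :
  (forall i, event (Q i)) -> event (fun w => forall i, Q i w).
Proof.
move=> eQ; apply: (@eq_event _ (fun w => ~ exists i, ~ Q i w)).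
  by move=> w; split=> [h [i]//|h i]; apply: contrapT => nq; apply: h; exists i.
by apply: event_not; apply: event_exists => i; exact: event_not.
Qed.

Lemma event_coord_le i (r : R) : event (fun w => coord i w <= r).
Proof.
rewrite /event (_ : [set w | _] = cylinder [:: i] (fun=> r%:E)).
  exact: measurable_cylinder.
apply/seteqP; split=> w /=; first by move=> h j; rewrite inE lee_fin => /eqP ->.
by move=> /(_ i); rewrite mem_head lee_fin; apply.
Qed.

Lemma event_site x v : event (fun w => est w x = v).
Proof.
have E0 := event_coord_le (inl (inl x)) 0.
have E1 := event_coord_le (inl (inl x)) 1.
case: v.
- apply: eq_event E0 => w /=; rewrite /site_to_R.
  by case: (est w x) => /=; rewrite ?lexx ?ler10 ?lern0.
- apply: eq_event (event_and E1 (event_not E0)) => w /=; rewrite /site_to_R.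
  case: (est w x) => /=; rewrite ?lexx ?ler10 ?lern0 ?lern1 ?ler01; split => //.
  + by case.
  + by case.
- apply: eq_event (event_not E1) => w /=; rewrite /site_to_R.
  by case: (est w x) => /=; rewrite ?lexx ?ler10 ?lern0 ?lern1 ?ler01; split.
Qed.

Lemma event_clock_le x (r : R) : event (fun w => eclk w x <= r).
Proof. exact: (event_coord_le (inl (inr x)) r). Qed.

Lemma event_step x k : event (fun w => estp w x k).
Proof.
apply: eq_event (event_not (event_coord_le (inr (x, k)) 0)) => w /=.
by case: (estp w x k); rewrite ?lexx ?ler10; split.
Qed.

Lemma event_step_eq v x k : event (fun w => estp w x k = v).
Proof.
case: v; first exact: event_step.
by apply: eq_event (event_not (event_step x k)) => w; split=> [->//|/negP/negbTE].
Qed.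

(** A rational between the two clocks reduces the comparison to countably many fixed thresholds. *)
Lemma event_clock_lt x y : event (fun w => eclk w x < eclk w y).
Proof.
apply: (@eq_event _ (fun w => exists q : rat, eclk w x <= ratr q /\ ~ eclk w y <= ratr q)).
  move=> w; split=> [/rat_in_itvoo[q]|[q [h1 /negP]]].
    by rewrite in_itv /= => /andP[h1 h2]; exists q; split; [exact: ltW|apply/negP; rewrite -ltNge].
  by rewrite -ltNge; exact: le_lt_trans.
by apply: event_exists => q; apply: event_and;
  [exact: event_clock_le|apply: event_not; exact: event_clock_le].
Qed.

Lemma event_clock_itv x (a b : R) : event (fun w => a < eclk w x <= b).
Proof.
apply: eq_event (event_and (event_not (event_clock_le x a)) (event_clock_le x b)) => w.
by rewrite ltNge; split=> [/andP[/negP]|[/negP -> ->]].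
Qed.

Lemma event_clock_eq x y : event (fun w => eclk w x = eclk w y).
Proof.
apply: eq_event (event_and (event_not (event_clock_lt x y)) (event_not (event_clock_lt y x))).
move=> w; case: ltgtP => h; split => //; try by case.
- by move=> e; rewrite e ltxx in h.
- by move=> e; rewrite e ltxx in h.
Qed.

Lemma event_clock_order x y : event (fun w => clock_order (eclk w) x y).
Proof.
apply: (@eq_event _ (fun w => eclk w x < eclk w y \/ (eclk w x = eclk w y /\ x <= y))).
  move=> w; rewrite /clock_order; split.
    by case/orP => [|/andP[/eqP]]; [left|right].
  by case=> [->//|[-> ->]]; rewrite eqxx orbT.
apply: event_or; first exact: event_clock_lt.
by apply: event_and; [exact: event_clock_eq|exact: event_const].
Qed.

Lemma event_active x : event (fun w => active w x).
Proof.
apply: (@eq_event _ (fun w => est w x = Ball /\ eclk w x <= 1)).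
  by move=> w; rewrite /active; split=> [/andP[/eqP]|[-> ->]].
exact: event_and (event_site _ _) (event_clock_le _ _).
Qed.

Lemma event_filter_active s t : event (fun w => [seq x <- s | active w x] = t).
Proof.
elim: s t => [|x s IH] t; first exact: (event_const ([::] = t)).
apply: (@eq_event _ (fun w =>
  (active w x /\ exists t', t = x :: t' /\ [seq x <- s | active w x] = t') \/
  (~ active w x /\ [seq x <- s | active w x] = t))).
  move=> w /=; case: ifP => ax; split.
  - by move=> <-; left; split => //; exists [seq x <- s | active w x].
  - by case=> [[_ [t' [-> ->]]]|[]].
  - by move=> <-; right.
  - by case=> [[]|[]].
apply: event_or.
- apply: event_and; first exact: event_active.
  apply: event_exists => t'; exact: (event_and (event_const (t = x :: t')) (IH t')).
- by apply: event_and; [apply: event_not; exact: event_active|exact: IH].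
Qed.

Lemma event_sorted t : event (fun w => sorted (clock_order (eclk w)) t).
Proof.
case: t => [|x t] /=; first exact: event_const.
elim: t x => [|y t IH] x /=; first exact: event_const.
apply: (@eq_event _ (fun w => clock_order (eclk w) x y /\ path (clock_order (eclk w)) y t)).
  by move=> w; split=> [/andP[]|[-> ->]].
exact: event_and (event_clock_order _ _) (IH _).
Qed.

(** The schedule is the unique sorted permutation of the active sites, and lists of integers are
    countable. *)
Lemma event_schedule s t : event (fun w => schedule w s = t).
Proof.
apply: (@eq_event _ (fun w => exists l, [seq x <- s | active w x] = l /\
    (perm_eq l t /\ sorted (clock_order (eclk w)) t))).
  move=> w; split=> [<-|[l [e [lt so]]]].
    exists [seq x <- s | active w x]; split => //; split.
      by rewrite perm_sym perm_sort.
    exact: sort_sorted (@clock_order_total _ w) _.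
  apply: (sorted_eq (@clock_order_trans _ w) (@clock_order_anti _ w)) => //.
    exact: sort_sorted (@clock_order_total _ w) _.
  by rewrite perm_sort e.
apply: event_exists => l; apply: event_and; first exact: event_filter_active.
by apply: event_and; [exact: event_const|exact: event_sorted].
Qed.

Lemma event_walk x n z : event (fun w => walk (estp w) x n = z).
Proof.
elim: n z => [|n IH] z.
  by apply: (@eq_event _ (fun=> x = z)); [move=> w; rewrite walk0|exact: event_const].
apply: (@eq_event _ (fun w => (estp w x n /\ walk (estp w) x n = z - 1) \/
   (~ estp w x n /\ walk (estp w) x n = z + 1))).
  move=> w; rewrite walkS; case: ifP => _; split.
  - by move=> <-; left; rewrite addrK.
  - by case=> [[_ ->]|[]//]; rewrite subrK.
  - by move=> <-; right; rewrite addrNK.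
  - by case=> [[]//|[_ ->]]; rewrite addrK.
apply: event_or.
- by apply: event_and; [exact: event_step|exact: IH].
- by apply: event_and; [apply: event_not; exact: event_step|exact: IH].
Qed.

Section Trajectories.
Variable tr : env R -> int -> nat -> int.
Hypothesis event_tr : forall x n z, event (fun w => tr w x n = z).

Lemma event_gfires (F : env R -> set int) t y :
  (forall z, event (fun w => F w z)) -> event (fun w => gfires (tr w) (F w) t y).
Proof.
elim: t F y => [|x t IH] F y eF; first exact: eF.
apply: IH => z; apply: event_and; first exact: eF.
apply: event_not; apply: event_and; first exact: eF.
apply: event_exists => n; apply: event_and; first exact: event_tr.
apply: event_forall => m; apply: event_imp; first exact: event_const.
apply: event_not; apply: (@eq_event _ (fun w => exists u, tr w x m = u /\ F w u)).
  by move=> w; split=> [h|[u [->]]//]; exists (tr w x m).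
by apply: event_exists => u; apply: event_and.
Qed.

(** The random firing order is handled by summing over the countably many values of the schedule. *)
Lemma event_gfires_schedule (F : env R -> set int) s y :
  (forall z, event (fun w => F w z)) ->
  event (fun w => gfires (tr w) (F w) (schedule w s) y).
Proof.
move=> eF; apply: (@eq_event _ (fun w => exists t, schedule w s = t /\
    gfires (tr w) (F w) t y)).
  by move=> w; split=> [h|[t [->]]//]; exists (schedule w s).
apply: event_exists => t; apply: event_and; first exact: event_schedule.
exact: event_gfires.
Qed.

End Trajectories.

Lemma event_holes_after s y : event (fun w => holes_after w s y).
Proof.
apply: event_gfires_schedule; first exact: event_walk.
by move=> z; exact: event_site.
Qed.

Lemma event_final y : event (fun w => final w y).
Proof.
apply: (@eq_event _ (fun w => forall s, uniq s -> holes_after w s y)).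
  by move=> w; exact: finalP.
apply: event_forall => s; apply: event_imp; first exact: event_const.
exact: event_holes_after.
Qed.

Lemma event_no_final x y : event (fun w => no_final w x y).
Proof.
apply: event_forall => z; apply: event_imp; first exact: event_const.
by apply: event_not; exact: event_final.
Qed.

Lemma event_block x y : event (fun w => block w x y).
Proof.
apply: (@eq_event _ (fun w => final w x /\ (final w y /\ no_final w x y))).
  by move=> w; split=> [[]|[? []]].
apply: event_and; first exact: event_final.
by apply: event_and; [exact: event_final|exact: event_no_final].
Qed.

Lemma event_chain x bs : event (fun w => chain w x bs).
Proof.
elim: bs x => [|b bs IH] x; first exact: event_final.
apply: (@eq_event _ (fun w => final w x /\ (no_final w x (x + (b.*2.+1)%:Z) /\
    chain w (x + (b.*2.+1)%:Z) bs))).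
  by move=> w /=; split=> [[]|[? []]].
apply: event_and; first exact: event_final.
by apply: event_and; [exact: event_no_final|exact: IH].
Qed.

Lemma event_cycle_free N y : event (fun w => cycle_free N w y).
Proof.
apply: event_gfires_schedule.
  move=> x n z; apply: (@eq_event _ (fun w => exists u : int,
      walk (estp w) x n = u /\ (u %% N%:Z)%Z = z)).
    by move=> w; split=> [h|[u [<-]]//]; exists (walk (estp w) x n).
  by apply: event_exists => u; apply: event_and; [exact: event_walk|exact: event_const].
by move=> z; apply: event_and; [exact: event_const|exact: event_site].
Qed.

Lemma event_cycle_unique N y : event (fun w => cycle_unique N w y).
Proof.
apply: event_and; first exact: event_cycle_free.
apply: event_forall => z; apply: event_imp; first exact: event_const.
by apply: event_imp; [exact: event_cycle_free|exact: event_const].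
Qed.

Lemma event_walk_far x (L : nat) n : event (fun w => L%:Z <= `|walk (estp w) x n - x|).
Proof.
apply: (@eq_event _ (fun w => exists u : int, walk (estp w) x n = u /\ L%:Z <= `|u - x|)).
  by move=> w; split=> [h|[u [<-]]//]; exists (walk (estp w) x n).
by apply: event_exists => u; apply: event_and; [exact: event_walk|exact: event_const].
Qed.

Lemma event_escapes N x : event (fun w => escapes N w x).
Proof. by apply: event_exists => n; exact: event_walk_far. Qed.

Lemma event_restrict (D : pred golf_index) Q : event Q -> event (fun w => Q (restrict D w)).
Proof. by move=> eQ; apply: (measurable_preimage _ eQ); exact: measurable_restrict. Qed.

Lemma event_reindex (f : int -> int) Q : injective f -> event Q ->
  event (fun w => Q (reindex f w)).
Proof. by move=> fi eQ; apply: (measurable_preimage _ eQ); exact: measurable_reindex. Qed.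

End Events.

(** * Probabilities *)

Section Prob.
Variables (R : realType) (mu : probability (env_space R) R).
Implicit Types (Q : env R -> Prop).

Definition prob Q : R := fine (mu [set w | Q w]).

Lemma probE Q : event Q -> mu [set w | Q w] = (prob Q)%:E.
Proof. by move=> eQ; rewrite /prob fineK // fin_num_measure. Qed.

Lemma prob_ext Q Q' : (forall w, Q w <-> Q' w) -> prob Q = prob Q'.
Proof.
move=> e; rewrite /prob (_ : [set w | Q w] = [set w | Q' w]) //.
by apply/seteqP; split=> w /= /e.
Qed.

Lemma prob_ge0 Q : 0 <= prob Q.
Proof. exact: fine_ge0. Qed.

Lemma prob_True : prob (fun=> True) = 1.
Proof. by rewrite /prob (_ : [set w | True] = setT) // probability_setT. Qed.

Lemma prob_not Q : event Q -> prob (fun w => ~ Q w) = 1 - prob Q.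
Proof.
move=> eQ; apply: EFin_inj; rewrite -probE; last exact: event_not.
by rewrite EFinB -probE // -probability_setC.
Qed.

Lemma sum_prob (I : Type) (s : seq I) (Q : I -> env R -> Prop) :
  (forall i, event (Q i)) ->
  (\sum_(i <- s) prob (Q i))%:E =
  (\int[mu]_w ((count (fun i => `[< Q i w >]) s)%:R)%:E)%E.
Proof.
move=> eQ.
transitivity (\int[mu]_w (\sum_(i <- s) (\1_[set w | Q i w] w)%:E))%E.
  rewrite ge0_integral_sum //.
  - rewrite -sumEFin; apply: eq_bigr => i _.
    rewrite integral_indic; [|exact: measurableT|exact: eQ].
    by rewrite setIT; apply/esym/probE.
  - by move=> i; apply/measurable_EFinP; apply: measurable_indic; exact: eQ.
apply: eq_integral => w _; rewrite sumEFin; congr (_%:E).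
rewrite -sum1_count natr_sum [RHS]big_mkcond /=; apply: eq_bigr => i _.
rewrite indicE; case: asboolP => h.
  by rewrite mem_set.
by rewrite memNset.
Qed.

(** First-moment method: a pointwise inequality between numbers of occurring events is integrated.
    Monotonicity, the union bound, additivity and the bound on filled holes are all deduced from
    it. *)
Lemma prob_count_le (I J : Type) (s : seq I) (t : seq J)
  (Q : I -> env R -> Prop) (Q' : J -> env R -> Prop) :
  (forall i, event (Q i)) -> (forall j, event (Q' j)) ->
  (forall w, (count (fun i => `[< Q i w >]) s <= count (fun j => `[< Q' j w >]) t)%N) ->
  \sum_(i <- s) prob (Q i) <= \sum_(j <- t) prob (Q' j).
Proof.
move=> eQ eQ' h.
have mcount (K : Type) (u : seq K) (V : K -> env R -> Prop) : (forall k, event (V k)) ->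
    measurable_fun setT (fun w : env_space R => ((count (fun i => `[< V i w >]) u)%:R : R)%:E).
  move=> eV; apply/measurable_EFinP.
  have -> : (fun w : env_space R => (count (fun i => `[< V i w >]) u)%:R : R) =
      (fun w => \sum_(i <- u) \1_[set w | V i w] w); last first.
    by apply: measurable_sum => k; apply: measurable_indic; exact: eV.
  apply/funext => w; rewrite -sum1_count natr_sum [in LHS]big_mkcond /=.
  apply: eq_bigr => i _; rewrite indicE; case: asboolP => hi.
    by rewrite mem_set.
  by rewrite memNset.
rewrite -lee_fin !sum_prob //; apply: ge0_le_integral => //.
- exact: (mcount _ s Q eQ).
- exact: (mcount _ t Q' eQ').
- by move=> w _; rewrite lee_fin ler_nat.
Qed.

Lemma prob_le Q Q' : event Q -> event Q' -> (forall w, Q w -> Q' w) -> prob Q <= prob Q'.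
Proof.
move=> eQ eQ' h.
have := @prob_count_le unit unit [:: tt] [:: tt] (fun=> Q) (fun=> Q') (fun=> eQ) (fun=> eQ').
rewrite !big_seq1; apply => w /=.
by have [/asboolP q|/asboolPn/negbTE ->] := pselect (Q w); rewrite // q asboolT //; apply: h; apply/asboolP.
Qed.

Lemma prob_le1 Q : event Q -> prob Q <= 1.
Proof. by move=> eQ; rewrite -prob_True; apply: prob_le => //; exact: event_const. Qed.

Lemma prob_or_le Q Q' : event Q -> event Q' ->
  prob (fun w => Q w \/ Q' w) <= prob Q + prob Q'.
Proof.
move=> eQ eQ'.
have := @prob_count_le unit bool [:: tt] [:: true; false]
  (fun _ w => Q w \/ Q' w) (fun b => if b then Q else Q')
  (fun=> event_or eQ eQ') (fun b => if b return event (if b then Q else Q') then eQ else eQ').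
rewrite big_seq1 big_cons big_seq1; apply => w /=.
by rewrite asbool_or; do 2 case: asboolP.
Qed.

Lemma prob_exclusive (I : eqType) (s : seq I) (Q : I -> env R -> Prop) :
  uniq s -> (forall i, event (Q i)) ->
  (forall w i j, i \in s -> j \in s -> Q i w -> Q j w -> i = j) ->
  \sum_(i <- s) prob (Q i) = prob (fun w => exists2 i, i \in s & Q i w).
Proof.
move=> us eQ dis.
have eE : event (fun w => exists2 i, i \in s & Q i w).
  elim: s {us dis} => [|i s IH].
    apply: (@eq_event _ _ (fun=> False)); last exact: event_const.
    by move=> w; split=> // -[].
  apply: eq_event (event_or (eQ i) IH) => w; split.
    by move=> [j]; rewrite inE => /predU1P[->|js Qj]; [left|right; exists j].
  move=> [Qi|[j js Qj]]; first by exists i; rewrite ?mem_head.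
  by exists j; rewrite ?inE ?js ?orbT.
have cE w : count (fun i => `[< Q i w >]) s = `[< exists2 i, i \in s & Q i w >].
  case: asboolP => [[i is_ Qi]|nE].
    rewrite (@eq_in_count _ _ (pred1 i)) ?count_uniq_mem ?is_ // => j js /=.
    by apply/asboolP/eqP => [Qj|->//]; exact: dis Qj Qi.
  apply/eqP; rewrite -leqn0 leqNgt -has_count; apply/hasP => -[i is_ /asboolP Qi].
  by apply: nE; exists i.
apply/eqP; rewrite eq_le; apply/andP; split.
- have := @prob_count_le I unit s [:: tt] Q _ eQ (fun=> eE).
  by rewrite big_seq1; apply => w; rewrite cE /= addn0.
- have := @prob_count_le unit I [:: tt] s _ Q (fun=> eE) eQ.
  by rewrite big_seq1; apply => w; rewrite cE /= addn0.
Qed.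

Definition sure Q := event Q /\ prob Q = 1.

Lemma sure_and Q Q' : sure Q -> sure Q' -> sure (fun w => Q w /\ Q' w).
Proof.
move=> [eQ Q1] [eQ' Q'1]; split; first exact: event_and.
have eN := event_not eQ; have eN' := event_not eQ'.
apply/eqP; rewrite eq_le prob_le1 ?andbT /=; last exact: event_and.
rewrite -subr_le0 -prob_not; last exact: event_and.
have -> : 0 = prob (fun w => ~ Q w) + prob (fun w => ~ Q' w).
  by rewrite !prob_not // Q1 Q'1 subrr addr0.
apply: le_trans (prob_or_le eN eN'); apply: prob_le.
- by apply: event_not; exact: event_and.
- exact: event_or.
- by move=> w /not_andP.
Qed.

Lemma sure_all (I : eqType) (s : seq I) (Q : I -> env R -> Prop) :
  (forall i, i \in s -> sure (Q i)) -> sure (fun w => {in s, forall i, Q i w}).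
Proof.
elim: s => [|i s IH] h.
  rewrite /sure (_ : (fun w => _) = (fun=> True)).
    by split; [exact: event_const|exact: prob_True].
  by apply/funext => w; apply/propext; split.
rewrite (_ : (fun w => _) = (fun w => Q i w /\ {in s, forall i, Q i w})).
  apply: sure_and; first by apply: h; rewrite mem_head.
  by apply: IH => j js; apply: h; rewrite inE js orbT.
apply/funext => w; apply/propext; split=> [hw|[Qi hw] j].
  by split=> [|j js]; apply: hw; rewrite ?mem_head // inE js orbT.
by rewrite inE => /predU1P[->//|/hw].
Qed.

Lemma prob_sure_eq Z Q Q' : sure Z -> event Q -> event Q' ->
  (forall w, Z w -> (Q w <-> Q' w)) -> prob Q = prob Q'.
Proof.
move=> [eZ Z1] eQ eQ' h.
have half V V' : event V -> event V' -> (forall w, Z w -> V w -> V' w) -> prob V <= prob V'.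
  move=> eV eV' hV; have eN := event_not eZ.
  apply: le_trans (_ : prob (fun w => V' w \/ ~ Z w) <= _).
    apply: prob_le => //; first exact: event_or.
    by move=> w Vw; have [/hV/(_ Vw)|] := pselect (Z w); [left|right].
  by apply: le_trans (prob_or_le eV' eN) _; rewrite prob_not // Z1 subrr addr0.
by apply/eqP; rewrite eq_le !half // => w /h e /e.
Qed.

End Prob.

(** * Almost sure properties of the environment and the factor of one gap *)

Section Golf.
Variables (R : realType) (mu : probability (env_space R) R) (rb rh p : R).
Hypotheses (mu_law : golf_law rb p mu) (rbh : rb + rh = 1) (p01 : 0 <= p <= 1).
Implicit Types (Q : env R -> Prop).

Local Notation prob := (prob mu).
Local Notation sure := (sure mu).

Lemma prob_reindex f Q : injective f -> event Q ->
  prob (fun w => Q (reindex f w)) = prob Q.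
Proof. by move=> fi eQ; rewrite /prob -(law_reindex mu_law fi eQ). Qed.

Lemma prob_shift r Q : event Q -> prob (fun w => Q (shift r w)) = prob Q.
Proof. by apply: prob_reindex; exact: addIr. Qed.

Lemma prob_indep (D1 D2 : pred golf_index) Q Q' : (forall i, D1 i -> ~~ D2 i) ->
  event Q -> event Q' ->
  prob (fun w => Q (restrict D1 w) /\ Q' (restrict D2 w)) =
  prob (fun w => Q (restrict D1 w)) * prob (fun w => Q' (restrict D2 w)).
Proof.
move=> dis eQ eQ'; have e1 := event_restrict D1 eQ; have e2 := event_restrict D2 eQ'.
apply: EFin_inj; rewrite EFinM -!probE //; last exact: event_and.
exact: (law_indep mu_law dis eQ eQ').
Qed.

Lemma prob_coord_le i r : prob (fun w => coord i w <= r) = cdf_at rb p i r.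
Proof.
apply: EFin_inj; rewrite -probE; last exact: event_coord_le.
rewrite (_ : [set w | _] = cylinder [:: i] (fun=> r%:E)).
  by rewrite mu_law // big_seq1.
apply/seteqP; split=> w /=; first by move=> h j; rewrite inE lee_fin => /eqP ->.
by move=> /(_ i); rewrite mem_head lee_fin; apply.
Qed.

Lemma prob_ball x : prob (fun w => est w x = Ball) = rb.
Proof.
rewrite -[RHS](_ : cdf_at rb p (inl (inl x)) 0 = _); last by rewrite /= ltxx ltr01.
rewrite -prob_coord_le; apply: prob_ext => w /=; rewrite /site_to_R.
by case: (est w x) => /=; rewrite ?lexx ?ler10 ?lern0.
Qed.

Lemma sure_not_neutral x : sure (fun w => est w x <> Neutral).
Proof.
split; first by apply: event_not; exact: event_site.
rewrite -[RHS](_ : cdf_at rb p (inl (inl x)) 1 = _); last by rewrite /= ltr10 ltxx.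
rewrite -prob_coord_le; apply: prob_ext => w /=; rewrite /site_to_R.
by case: (est w x) => /=; rewrite ?lexx ?ler10 ?lern0 ?lern1 ?ler01; split.
Qed.

Lemma prob_hole x : prob (fun w => est w x = Hole) = rh.
Proof.
have -> : rh = 1 - rb by rewrite -rbh addrAC subrr add0r.
rewrite -(prob_ball x) -prob_not; last exact: event_site.
apply: (prob_sure_eq (sure_not_neutral x)); first exact: event_site.
  by apply: event_not; exact: event_site.
by move=> w; case: (est w x).
Qed.

Lemma sure_clock_le1 x : sure (fun w => eclk w x <= 1).
Proof.
split; first exact: event_clock_le.
by rewrite (prob_coord_le (inl (inr x)) 1) /= ltr10 lexx.
Qed.

Lemma prob_clock_le x t : 0 <= t <= 1 -> prob (fun w => eclk w x <= t) = t.
Proof.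
by move=> /andP[t0 t1]; rewrite (prob_coord_le (inl (inr x)) t) /= ltNge t0 t1.
Qed.

Lemma prob_clock_itv x s t : 0 <= s -> s <= t -> t <= 1 ->
  prob (fun w => s < eclk w x <= t) = t - s.
Proof.
move=> s0 st t1.
have := @prob_exclusive R mu bool [:: true; false]
  (fun b w => if b then eclk w x <= s else s < eclk w x <= t).
rewrite big_cons big_seq1 prob_clock_le ?s0 ?(le_trans st) // => h.
apply: (addrI s); rewrite h //; last 2 first.
- by case; [exact: event_clock_le|exact: event_clock_itv].
- by move=> w [] [] //= _ _; [move=> a /andP[b _]|move=> /andP[b _] a];
    move: a; rewrite leNgt b.
rewrite addrC subrK -[RHS](prob_clock_le x (t := t)) ?t1 ?(le_trans s0) //.
apply: prob_ext => w; split=> [[[] _]|h'].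
- by move=> h'; exact: le_trans st.
- by case/andP.
- by case: (leP (eclk w x) s) => hs; [exists true|exists false => //; rewrite hs].
Qed.

Lemma prob_two_clocks x y s t : x != y -> 0 <= s -> s <= t -> t <= 1 ->
  prob (fun w => s < eclk w x <= t /\ s < eclk w y <= t) = (t - s) ^+ 2.
Proof.
move=> xy s0 st t1.
(* Each clock is read from the environment restricted to its own site, the form in which
   independence is available. *)
have eR z w : (s < eclk w z <= t) = (s < eclk (restr (pred1 z) w) z <= t).
  by rewrite /= /on_sites /= eqxx.
rewrite -[LHS](_ : prob (fun w => (s < eclk (restr (pred1 x) w) x <= t) /\
  (s < eclk (restr (pred1 y) w) y <= t)) = _); last first.
  by apply: prob_ext => w; rewrite -!eR.
rewrite (prob_indep (Q := fun w => s < eclk w x <= t) (Q' := fun w => s < eclk w y <= t));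
  try exact: event_clock_itv.
  rewrite expr2; congr (_ * _).
    by rewrite -(prob_clock_itv x s0 st t1); apply: prob_ext => w; rewrite -eR.
  by rewrite -(prob_clock_itv y s0 st t1); apply: prob_ext => w; rewrite -eR.
by move=> i; rewrite /on_sites /= => /eqP ->.
Qed.

(* Two equal clocks in (0, 1] fall in the same of the [n.+1] subintervals of length
   [1 / n.+1]. *)
Lemma prob_tie_le x y n j : x != y -> (j <= n.+1)%N ->
  prob (fun w => 0 < eclk w x <= j%:R / n.+1%:R /\ eclk w x = eclk w y) <=
  j%:R / n.+1%:R ^+ 2.
Proof.
move=> xy; have n0 : 0 < n.+1%:R :> R by rewrite ltr0n.
have eT (a b : R) : event (fun w => a < eclk w x <= b /\ eclk w x = eclk w y).
  by apply: event_and; [exact: event_clock_itv|exact: event_clock_eq].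
have eT' (a b : R) : event (fun w : env R => a < eclk w x <= b /\ a < eclk w y <= b).
  by apply: event_and; exact: event_clock_itv.
elim: j => [|j IH] jn.
  rewrite !mul0r (prob_ext _ (Q' := fun=> ~ True)).
    by rewrite prob_not ?prob_True ?subrr //; exact: event_const.
  by move=> w; split=> // -[/andP[a b] _]; have := lt_le_trans a b; rewrite ltxx.
have step : j.+1%:R / n.+1%:R - j%:R / n.+1%:R = n.+1%:R^-1 :> R.
  by rewrite -mulrBl -natrB // subSnn mul1r.
have j0 : 0 <= j%:R / n.+1%:R :> R by rewrite divr_ge0 // ler0n.
have jj : j%:R / n.+1%:R <= j.+1%:R / n.+1%:R :> R by rewrite ler_pM2r ?invr_gt0 // ler_nat.
have j1 : j.+1%:R / n.+1%:R <= 1 :> R by rewrite ler_pdivrMr // mul1r ler_nat.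
have two := prob_two_clocks xy j0 jj j1; rewrite step in two.
have -> : j.+1%:R / n.+1%:R ^+ 2 = j%:R / n.+1%:R ^+ 2 + n.+1%:R^-1 ^+ 2 :> R.
  by rewrite -(natr1 j) mulrDl mul1r exprVn.
rewrite -two.
apply: le_trans (_ : prob (fun w =>
   (0 < eclk w x <= j%:R / n.+1%:R /\ eclk w x = eclk w y) \/
   (j%:R / n.+1%:R < eclk w x <= j.+1%:R / n.+1%:R /\
    j%:R / n.+1%:R < eclk w y <= j.+1%:R / n.+1%:R)) <= _).
  apply: prob_le => //; first exact: event_or.
  move=> w [/andP[a b] e]; case: (leP (eclk w x) (j%:R / n.+1%:R)) => h.
    by left; split => //; apply/andP.
  by right; split; apply/andP; rewrite -?e.
apply: le_trans (prob_or_le mu (eT _ _) (eT' _ _)) _.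
by rewrite lerD2r; apply: IH; exact: ltnW.
Qed.

(** Over all [n.+1] subintervals, the bound of [prob_tie_le] becomes [1 / n.+1], for every [n]. *)
Lemma sure_no_tie x y : x != y -> sure (fun w => eclk w x <> eclk w y).
Proof.
move=> xy; have eE := @event_clock_eq R x y.
have ePos : event (fun w : env R => 0 < eclk w x <= 1) by exact: event_clock_itv.
have sP : sure (fun w => 0 < eclk w x <= 1).
  by split => //; rewrite prob_clock_itv // subr0.
split; first exact: event_not.
rewrite prob_not //; apply/eqP; rewrite subr_eq addrC -subr_eq subrr eq_sym.
rewrite eq_le prob_ge0 andbT leNgt; apply/negP => /ltr_add_invr[n].
rewrite add0r ltNge => /negP; apply.
have -> : prob (fun w => eclk w x = eclk w y) =
    prob (fun w => 0 < eclk w x <= n.+1%:R / n.+1%:R /\ eclk w x = eclk w y).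
  apply: (prob_sure_eq sP) => //.
    by apply: event_and => //; rewrite divff ?pnatr_eq0.
  by move=> w h; rewrite divff ?pnatr_eq0 // h; split=> [|[]].
apply: le_trans (prob_tie_le xy (leqnn _)) _.
by rewrite expr2 invfM mulrA divff ?pnatr_eq0 // mul1r.
Qed.

Definition step_prob (v : bool) : R := if v then p else 1 - p.

Lemma prob_step v x k : prob (fun w => estp w x k = v) = step_prob v.
Proof.
have eF : event (fun w : env R => estp w x k = false) by exact: event_step_eq.
have F : prob (fun w => estp w x k = false) = 1 - p.
  rewrite -[RHS](_ : cdf_at rb p (inr (x, k)) 0 = _); last by rewrite /= ltxx ltr01.
  rewrite -prob_coord_le; apply: prob_ext => w /=.
  by case: (estp w x k); rewrite ?lexx ?ler10.
case: v => //=; rewrite -[RHS](subKr 1) -F -prob_not //.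
by apply: prob_ext => w; case: (estp w x k); split.
Qed.

Definition run (v : bool) x m l (w : env R) := forall k, (m <= k < m + l)%N -> estp w x k = v.

Lemma event_run v x m l : event (run v x m l).
Proof.
by apply: event_forall => k; apply: event_imp; [exact: event_const|exact: event_step_eq].
Qed.

Lemma prob_run v x m l : prob (run v x m l) = step_prob v ^+ l.
Proof.
elim: l => [|l IH].
  rewrite expr0 -(prob_True mu); apply: prob_ext => w; split=> // _ k.
  by rewrite addn0 => /andP[a b]; have := leq_ltn_trans a b; rewrite ltnn.
(* Here independence is between times, not sites: the steps before [m + l] against the step at
   [m + l]. *)
pose D1 : pred golf_index := fun i => if i is inr (_, k) then (k < m + l)%N else false.
pose D2 : pred golf_index := fun i => if i is inr (_, k) then (m + l <= k)%N else false.
have eS : event (fun w : env R => estp w x (m + l) = v) by exact: event_step_eq.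
have e1 w : run v x m l w <-> run v x m l (restrict D1 w).
  by split=> h k /[dup] /andP[_ kl] /h; rewrite /= kl.
rewrite (prob_ext _ (Q' := fun w => run v x m l (restrict D1 w) /\
   estp (restrict D2 w) x (m + l) = v)); last first.
  move=> w; rewrite -e1 /= leqnn; split=> [h|[h1 h2] k].
    by split=> [k /andP[a b]|]; apply: h; lia.
  by move=> kml; have [->//|kne] := eqVneq k (m + l)%N; apply: h1; lia.
rewrite (prob_indep (Q := run v x m l) (Q' := fun w => estp w x (m + l) = v)) //.
- rewrite exprSr -IH -(prob_step v x (m + l)); congr (_ * _).
    by apply: prob_ext => w; rewrite -e1.
  by apply: prob_ext => w; rewrite /= leqnn.
- by case=> // -[z k] /=; rewrite ltnNge.
- exact: event_run.
Qed.

Lemma walk_run (w : env R) v x m l : run v x m l w ->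
  walk (estp w) x (m + l) = walk (estp w) x m + (if v then l%:Z else - l%:Z).
Proof.
elim: l => [|l IH] h; first by rewrite addn0; case: (v); rewrite ?oppr0 addr0.
rewrite addnS walkS IH => [|k kl]; last by apply: h; lia.
by rewrite h; [case: (v); lia|lia].
Qed.

(* A run of [2 * N] equal steps leads out of every interval of length less than [2 * N],
   and disjoint blocks of steps are independent. *)
Lemma sure_escapes N x : (0 < N)%N -> sure (fun w => escapes N w x).
Proof.
move=> N0; have eE := @event_escapes R N x; split => //.
pose stay m (w : env R) := forall n, (n <= m)%N -> `|walk (estp w) x n - x| < N%:Z.
have eS m : event (stay m).
  apply: event_forall => n; apply: event_imp; first exact: event_const.
  apply: eq_event (event_not (@event_walk_far R x N n)) => w.
  by rewrite ltNge; split=> [/negP|/negP].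
pose L := N.*2.
(* The direction of the run is chosen to have positive probability, which also covers [p = 0] and
   [p = 1]. *)
have [v v0] : exists v, 0 < step_prob v.
  have [p0|p0] := ltP 0 p; first by exists true.
  by exists false; rewrite /= subr_gt0 (le_lt_trans p0).
have v1 : step_prob v <= 1.
  by rewrite -(prob_step v 0 0); apply: prob_le1; exact: event_step_eq.
pose q := step_prob v ^+ L.
have q0 : 0 < q by exact: exprn_gt0.
have q1 : q <= 1 by apply: exprn_ile1 => //; exact: ltW.
(* A walk within distance less than [N] at times [m] and [m + L] cannot have made [2 * N] equal
   steps in between; that block of steps is independent of the past. *)
have step m : prob (stay (m + L)%N) <= prob (stay m) * (1 - q).
  pose D1 : pred golf_index := fun i => if i is inr (_, k) then (k < m)%N else false.
  pose D2 : pred golf_index := fun i => if i is inr (_, k) then (m <= k)%N else false.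
  have e1 w : stay m w <-> stay m (restrict D1 w).
    suff wE n : (n <= m)%N -> walk (estp (restrict D1 w)) x n = walk (estp w) x n.
      by split=> h n nm; have := h n nm; rewrite wE.
    move=> nm; rewrite /walk; congr (_ + _); apply: eq_bigr => -[k kn] _ /=.
    by rewrite (leq_trans kn nm).
  have e2 w : run v x m L w <-> run v x m L (restrict D2 w).
    by split=> h k /[dup] /andP[km _] /h; rewrite /= km.
  have eN := event_not (event_run v x m L).
  have -> : 1 - q = prob (fun w => ~ run v x m L (restrict D2 w)).
    rewrite prob_not /q; last by apply: event_restrict; exact: event_run.
    by rewrite -(prob_run v x m L); congr (_ - _); apply: prob_ext => w; rewrite -e2.
  rewrite (prob_ext mu e1) -(prob_indep (Q := stay m) (Q' := fun w => ~ run v x m L w)) //.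
    apply: prob_le => //.
      by apply: event_and; [exact: event_restrict|exact: (event_restrict D2 eN)].
    move=> w h; have sm : stay m w by move=> n nm; apply: h; lia.
    split; first by apply (e1 w).1.
    move=> hr; have /walk_run wE := (e2 w).2 hr.
    have h1 := h m (leq_addr _ _); have h2 := h (m + L)%N (leqnn _).
    by move: h1 h2; rewrite wE /L; case: (v); lia.
  by case=> // -[z k] /=; rewrite -ltnNge.
have bound n : prob (fun w => ~ escapes N w x) <= (1 - q) ^+ n.
  apply: (@le_trans _ _ (prob (stay (n * L)%N))).
    apply: prob_le => //; first exact: event_not.
    by move=> w nE n' _; rewrite ltNge; apply/negP => h; apply: nE; exists n'.
  elim: n => [|n IH]; first by rewrite expr0; exact: prob_le1.
  rewrite mulSn addnC exprSr; apply: le_trans (step _) _.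
  by apply: ler_wpM2r => //; rewrite subr_ge0.
have lim0 : (1 - q) ^+ n @[n --> \oo] --> (0 : R).
  by apply: cvg_expr; rewrite ger0_norm ?subr_ge0 // ltrBlDr ltrDl.
have : prob (fun w => ~ escapes N w x) <= 0.
  rewrite -(cvg_lim _ lim0) //; apply: limr_ge; first by apply/cvg_ex; exists 0.
  exact: nearW.
by rewrite prob_not // subr_le0 => h; apply/eqP; rewrite eq_le h prob_le1.
Qed.

Lemma event_ball_count s b :
  event (fun w : env R => count (fun x => est w x == Ball) s = b).
Proof.
elim: s b => [|x s IH] b; first exact: (@event_const R (0%N = b)).
apply: (@eq_event _ _ (fun w => (est w x = Ball /\
     exists c, count (fun x => est w x == Ball) s = c /\ c.+1 = b) \/
   (est w x <> Ball /\ count (fun x => est w x == Ball) s = b))).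
  move=> w /=; case: eqP => h; split.
  - by move=> <-; left; split => //; exists (count (fun x => est w x == Ball) s).
  - by case=> [[_ [c [-> <-]]]|[]].
  - by move=> <-; right.
  - by case=> [[]|[_ ->]].
apply: event_or; apply: event_and.
- exact: event_site.
- by apply: event_exists => c; apply: event_and; [exact: IH|exact: event_const].
- by apply: event_not; exact: event_site.
- exact: IH.
Qed.

Lemma prob_ball_count s b : uniq s ->
  prob (fun w => count (fun x => est w x == Ball) s = b) =
  'C(size s, b)%:R * rb ^+ b * rh ^+ (size s - b).
Proof.
elim: s b => [|x s IH] b /=.
  move=> _; case: b => [|b]; rewrite /= ?bin0 ?bin0n ?mul0r ?expr0 ?mulr1.
    by rewrite -[RHS](prob_True mu); apply: prob_ext.
  rewrite (prob_ext mu (Q' := fun=> ~ True)); first by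
    rewrite prob_not ?prob_True ?subrr //; exact: event_const.
  by move=> w; split.
move=> /andP[xs us].
pose B (w : env R) c := count (fun x => est w x == Ball) s = c.
have eB c : event (fun w : env R => B w c) by exact: event_ball_count.
have eN : event (fun w : env R => est w x <> Ball) by apply: event_not; exact: event_site.
have BR w c : B (restr (mem s) w) c <-> B w c.
  rewrite /B; rewrite (@eq_in_count _ _ (fun x => est w x == Ball)) // => y ys /=.
  by rewrite /on_sites /= ys.
have indep (V : env R -> Prop) c : event V -> (forall w, V (restr (pred1 x) w) <-> V w) ->
    prob (fun w => V w /\ B w c) = prob V * prob (fun w => B w c).
  move=> eV VR.
  rewrite (prob_ext mu (Q' := fun w => V (restr (pred1 x) w) /\ B (restr (mem s) w) c)).
    rewrite (prob_indep (Q' := fun w => B w c)) //.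
      by congr (_ * _); apply: prob_ext => w; rewrite ?VR ?BR.
    by move=> i; rewrite /on_sites /= => /eqP ->.
  by move=> w; rewrite VR BR.
have pB c : prob (fun w => est w x = Ball /\ B w c) =
    rb * ('C(size s, c)%:R * rb ^+ c * rh ^+ (size s - c)).
  rewrite (indep (fun w => est w x = Ball)) ?prob_ball ?IH //; first exact: event_site.
  by move=> w; rewrite /= /on_sites /= eqxx.
have pN c : prob (fun w => est w x <> Ball /\ B w c) =
    rh * ('C(size s, c)%:R * rb ^+ c * rh ^+ (size s - c)).
  rewrite (indep (fun w => est w x <> Ball)) //; last first.
    by move=> w; rewrite /= /on_sites /= eqxx.
  rewrite IH // prob_not; last exact: event_site.
  by rewrite prob_ball -{1}rbh addrAC subrr add0r.
case: b => [|b].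
  rewrite (prob_ext mu (Q' := fun w => est w x <> Ball /\ B w 0%N)); last first.
    move=> w; rewrite /B; case: eqP => h; split=> //= -[] //.
  by rewrite pN !bin0 !subn0 expr0 !mul1r exprS.
have := @prob_exclusive R mu bool [:: true; false]
  (fun v w => if v then est w x = Ball /\ B w b else est w x <> Ball /\ B w b.+1).
rewrite big_cons big_seq1 pB pN => h.
rewrite (prob_ext mu (Q' := fun w => exists2 v, v \in [:: true; false] &
  if v then est w x = Ball /\ B w b else est w x <> Ball /\ B w b.+1)); last first.
  move=> w; rewrite /B; case: eqP => hb; split=> //.
  - by move=> [hc]; exists true.
  - by move=> [[] _] [] // _ ->.
  - by move=> hc; exists false.
  - by move=> [[] _] [] // _ ->.
rewrite -h //; last 2 first.
- by case; apply: event_and => //; exact: event_site.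
- by move=> w [] [] // _ _ [] ? ? [].
rewrite binS natrD !mulrDl subSS addrC; congr (_ + _).
  (* Pascal's rule leaves powers with truncated exponents. They match when [b < size s]; otherwise
     the binomial coefficient in that term vanishes. *)
  have [sb|bs] := ltnP b (size s).
    have -> : (size s - b = (size s - b.+1).+1)%N by lia.
    by rewrite [rh ^+ _.+1]exprS; ring.
  by rewrite bin_small ?ltnS // !mul0r mulr0.
by rewrite exprS; ring.
Qed.

Hypothesis rh_gt0 : 0 < rh.

(** The Catalan number in the form produced by the cycle: placements of [b] balls on [2 * b + 1]
    sites, divided by the number of rotations. *)
Lemma catalan_binE b : 'C(b.*2.+1, b)%:R / b.*2.+1%:R = catalan b :> R.
Proof.
rewrite /catalan; apply/eqP; rewrite eqr_div ?pnatr_eq0 // -!natrM eqr_nat.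
have := mul_bin_diag b.*2.+1 b; rewrite /= => e.
have -> : 'C(b.*2.+1, b) = 'C(b.*2.+1, b.+1).
  by rewrite -(bin_sub (m := b.+1)); [congr 'C(_, _); lia|lia].
by rewrite mulnC -e mulnC.
Qed.

(* Cycle lemma: on a cycle of length [2 * b + 1] exactly one site remains free iff there
   are [b] balls, and by rotation invariance it is equally likely to be any of the sites. *)
Lemma prob_block0 b :
  prob (fun w => block (restr (fun x => 0 < x < b.*2.+1%:Z) w) 0 b.*2.+1%:Z) =
  catalan b * (rb * rh) ^+ b.
Proof.
set N := b.*2.+1; have N0 : (0 < N)%N by [].
pose V (w : env R) := block (restr (fun x => 0 < x < N%:Z) w) 0 N%:Z.
have eV : event V.
  exact: (event_restrict (on_sites (fun x => 0 < x < N%:Z)) (event_block 0 N%:Z)).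
have eU r : event (fun w : env R => cycle_unique N w r) by exact: event_cycle_unique.
(* The cycle event also asks that [0] be a hole, which costs [rh] independently of the interior of
   the interval. *)
have VU : rh * prob V = prob (fun w => cycle_unique N w 0).
  have -> : prob (fun w => cycle_unique N w 0) =
      prob (fun w => est (restr (pred1 (0 : int)) w) 0 = Hole /\ V w).
    by apply: prob_ext => w; rewrite -block_cycle //= /on_sites /= eqxx.
  rewrite (prob_indep (D1 := on_sites (pred1 (0 : int))) (Q := fun w => est w 0 = Hole)
    (D2 := on_sites (fun x => 0 < x < N%:Z)) (Q' := fun w => block w 0 N%:Z)).
  - have e : prob (fun w => est (restr (pred1 (0 : int)) w) 0 = Hole) = rh.
      by rewrite -(prob_hole 0); exact: prob_ext.
    by rewrite [X in _ = X * _]e.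
  - by move=> i; rewrite /on_sites /= => /eqP ->.
  - exact: event_site.
  - exact: event_block.
pose S := cycle_sites N.
have uS : uniq S by exact: cycle_sites_uniq.
have noties : sure (fun w => {in S, forall x, {in S, forall y, x != y -> eclk w x <> eclk w y}}).
  apply: sure_all => x _; apply: sure_all => y _.
  have [<-|xy] := eqVneq x y.
    rewrite /sure (_ : (fun w => _) = (fun=> True)).
      by split; [exact: event_const|exact: prob_True].
    by apply/funext => w; apply/propext; split.
  have := sure_no_tie xy; rewrite /sure (_ : (fun w => _) = (fun w => true -> eclk w x <> eclk w y)) //.
  by apply/funext => w; apply/propext; split => // h; exact: h.
have rot r : r \in S -> prob (fun w => cycle_unique N w r) = prob (fun w => cycle_unique N w 0).
  rewrite (mem_cycle_sites N0) => rN.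
  rewrite -(prob_reindex (f := rotate N r) _ (eU 0)); last exact: (rotate_inj N0).
  apply: (prob_sure_eq noties) => //.
    exact: (event_reindex (@rotate_inj N N0 r) (eU 0)).
  move=> w nt; rewrite (cycle_unique_rotate N0) // => x y xS yS e.
  by have [//|xy] := eqVneq x y; case: (nt x xS y yS xy).
have good : sure (fun w => {in S, forall x, escapes N w x /\ (eclk w x <= 1 /\ est w x <> Neutral)}).
  apply: sure_all => x _; apply: sure_and; first exact: sure_escapes.
  by apply: sure_and; [exact: sure_clock_le1|exact: sure_not_neutral].
have sumE : \sum_(r <- S) prob (fun w => cycle_unique N w r) =
    'C(N, b)%:R * rb ^+ b * rh ^+ b.+1.
  rewrite prob_exclusive //; last first.
    move=> w i j; rewrite !(mem_cycle_sites N0) => iN jN [ui _] [_ uj].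
    exact: uj.
  have -> : rh ^+ b.+1 = rh ^+ (size S - b).
    by congr (_ ^+ _); rewrite size_map size_iota /N; lia.
  rewrite -[N in 'C(N, b)](_ : size S = N); last by rewrite size_map size_iota.
  rewrite -prob_ball_count //.
  apply: (prob_sure_eq good).
  - apply: (@eq_event _ _ (fun w => exists r, (r \in S) /\ cycle_unique N w r)).
      by move=> w; split=> [[r]|[r []]]; exists r.
    by apply: event_exists => r; apply: event_and; [exact: event_const|exact: eU].
  - exact: event_ball_count.
  - move=> w g; rewrite -(@cycle_unique_balls R N N0 w b) //.
      by split=> -[r h u]; exists r => //; move: h; rewrite (mem_cycle_sites N0).
    by move=> x /g [? []].
(* All [N] terms equal [rh * prob V] and their sum is the binomial probability of [b] balls;
   cancelling [N] and one factor [rh] leaves the claim. *)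
move: sumE; rewrite (eq_big_seq (fun=> prob (fun w => cycle_unique N w 0))) //.
rewrite big_const_seq count_predT size_map size_iota iter_addr_0 -VU => e.
have NR : N%:R != 0 :> R by rewrite pnatr_eq0.
apply: (mulfI (lt0r_neq0 rh_gt0)); apply: (mulfI NR).
rewrite -/V mulr_natl e -catalan_binE -/N exprMn exprS.
by field.
Qed.

Lemma block_shift r (w : env R) x y : block (shift r w) x y <-> block w (x + r) (y + r).
Proof.
rewrite /block; split=> -[/final_shift h1 /final_shift h2 h3]; split => //.
- move=> z zxy fz; apply: (h3 (z - r)); first by lia.
  by apply/final_shift; rewrite subrK.
- by move=> z zxy /final_shift; apply: h3; lia.
Qed.

Lemma prob_block c b : let c' := c + b.*2.+1%:Z in
  prob (fun w => block (restr (fun x => c < x < c') w) c c') =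
  catalan b * (rb * rh) ^+ b.
Proof.
move=> c'; rewrite -prob_block0.
rewrite -(prob_shift c (Q := fun w => block (restr (fun x => 0 < x < b.*2.+1%:Z) w) 0 b.*2.+1%:Z)).
  apply: prob_ext => w; rewrite restr_shift block_shift add0r.
  rewrite [_ + c]addrC -/c' (@eq_restr R _ (fun x => c < x < c')) // => x.
  by rewrite /= /c'; apply/idP/idP; lia.
exact: (event_restrict (on_sites (fun x => 0 < x < b.*2.+1%:Z)) (event_block 0 _)).
Qed.

End Golf.

(** * Density of free holes and chains of gaps *)

(** Each firing removes at most one hole, because a trajectory has only one first hit. *)
Lemma count_removed tr (F : set int) s t : uniq s ->
  (count (fun y => `[< F y /\ ~ gfires tr F t y >]) s <= size t)%N.
Proof.
move=> us; elim: t F => [|x t IH] F /=.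
  rewrite leqn0 -leqn0 leqNgt -has_count; apply/hasP => -[y _ /asboolP[]//].
pose h y := `[< hits tr F x y >].
have one : (count h s <= 1)%N.
  have [[y hy]|nh] := pselect (exists y, hits tr F x y); last first.
    rewrite (@eq_count _ _ pred0) ?count_pred0 // => y.
    by apply/asboolP => hy; apply: nh; exists y.
  rewrite (@eq_count _ _ (pred1 y)) ?count_uniq_mem ?leq_b1 // => z.
  by apply/asboolP/eqP => [/hits_unique|->//]; apply.
apply: leq_trans (_ : (count h s + count (fun y => `[< gfire tr F x y /\
    ~ gfires tr (gfire tr F x) t y >]) s <= _)%N); last first.
  by rewrite -add1n; apply: leq_add.
rewrite -count_predUI; apply: leq_trans (leq_addr _ _).
apply: sub_count => y /= /asboolP[Fy nF].
have [hy|nhy] := pselect (hits tr F x y); first by rewrite /h asboolT.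
by apply/orP; right; apply/asboolP.
Qed.

Section Density.
Variables (R : realType) (mu : probability (env_space R) R) (rb rh p : R).
Hypotheses (mu_law : golf_law rb p mu) (rbh : rb + rh = 1).

Local Notation prob := (prob mu).

Lemma removed_balls (w : env R) s t : uniq s ->
  (count (fun y => `[< est w y = Hole /\ ~ holes_after w t y >]) s <=
   count (fun x => `[< est w x = Ball >]) t)%N.
Proof.
move=> us; apply: leq_trans (count_removed _ _ _ us) _.
rewrite size_sort size_filter; apply: sub_count => x /andP[/eqP h _].
exact/asboolP.
Qed.

(* Sites filled in their own window of radius [k] are filled in a larger window, where
   each ball fills at most one site; boundary effects vanish as that window grows. *)
Lemma prob_removed_le k :
  prob (fun w => est w 0 = Hole /\ ~ holes_after w (window k) 0) <= rb.
Proof.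
set q := prob _.
pose Q y (w : env R) := est w y = Hole /\ ~ holes_after w [seq x + y | x <- window k] y.
have eQ y : event (Q y).
  by apply: event_and; [exact: event_site|apply: event_not; exact: event_holes_after].
have qE y : prob (Q y) = q.
  rewrite /q -[RHS](prob_shift mu_law y); last first.
    by apply: event_and; [exact: event_site|apply: event_not; exact: event_holes_after].
  apply: prob_ext => w; rewrite /Q.
  have := holes_after_shift y w (window k) 0; rewrite add0r => hs.
  have -> : est (shift y w) 0 = est w y by rewrite /= add0r.
  by split=> -[h1 h2]; split=> // /hs.
have size_window n : size (window n) = n.*2.+1 by rewrite size_map size_iota.
(* Expected numbers are compared: filled sites in the window of radius [m] against balls in the
   window of radius [m + k], which contains every local window involved. *)
have bound m : m.*2.+1%:R * q <= (m + k).*2.+1%:R * rb.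
  suff H : \sum_(y <- window m) prob (Q y) <=
      \sum_(x <- window (m + k)) prob (fun w => est w x = Ball).
    move: H; rewrite (eq_bigr (fun=> q)) // [X in _ <= X](eq_bigr (fun=> rb)); last first.
      by move=> x _; exact: (prob_ball mu_law).
    by rewrite !big_const_seq !count_predT !size_window !iter_addr_0 !mulr_natl.
  apply: prob_count_le => // [x|w]; first exact: event_site.
  apply: leq_trans (removed_balls w (window (m + k)) (window_uniq m)).
  rewrite -!size_filter; apply: uniq_leq_size; first exact/filter_uniq/window_uniq.
  move=> y; rewrite !mem_filter => /andP[/asboolP[hy nf] ym]; rewrite ym andbT.
  apply/asboolP; split => // hf; apply: nf; apply: holes_after_anti hf.
  - by rewrite map_inj_uniq ?window_uniq //; exact: addIr.
  - exact: window_uniq.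
  - move=> _ /mapP[x xk ->]; move: xk ym; rewrite !mem_window; lia.
rewrite leNgt; apply/negP => rbq.
(* If [q > rb], this [m] makes the gain [(2 * m + 1) * (q - rb)] exceed the boundary term
   [2 * k * rb], against [bound m]. *)
pose m := (Num.Def.trunc (k.*2%:R * rb / (q - rb))).+1.
have mgt : k.*2%:R * rb / (q - rb) < m%:R by exact: truncnS_gt.
have d0 : 0 < q - rb by rewrite subr_gt0.
have := bound m; rewrite leNgt => /negP; apply.
rewrite ltr_pdivrMr // in mgt.
have -> : (m + k).*2.+1%:R * rb = m.*2.+1%:R * rb + k.*2%:R * rb.
  by rewrite -mulrDl -natrD doubleD addSn.
rewrite -ltrBrDl -mulrBr; apply: lt_le_trans mgt _.
by rewrite ler_pM2r // ler_nat; lia.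
Qed.

Lemma prob_holes_after_ge k : rh - rb <= prob (fun w => holes_after w (window k) 0).
Proof.
have eH : event (fun w : env R => holes_after w (window k) 0) by exact: event_holes_after.
have eQ : event (fun w : env R => est w 0 = Hole /\ ~ holes_after w (window k) 0).
  by apply: event_and; [exact: event_site|exact: event_not].
rewrite lerBlDr -(prob_hole mu_law rbh 0).
apply: le_trans (_ : prob (fun w => holes_after w (window k) 0) +
  prob (fun w => est w 0 = Hole /\ ~ holes_after w (window k) 0) <= _); last first.
  by rewrite lerD2l; exact: prob_removed_le.
apply: le_trans (prob_or_le mu eH eQ); apply: prob_le.
- exact: event_site.
- exact: event_or.
- by move=> w h; have [|] := pselect (holes_after w (window k) 0); [left|right].
Qed.

(** Continuity from above along the decreasing events that [0] is free in the window of radius [k];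
    the bound is uniform in [k]. *)
Lemma prob_final_ge : rh - rb <= prob (fun w => final w 0).
Proof.
pose F k : set (env_space R) := [set w | holes_after w (window k) 0].
have mF k : measurable (F k) by exact: event_holes_after.
have FE : [set w : env_space R | final w 0] = \bigcap_k F k.
  apply/seteqP; split=> w /=.
    by move=> /finalP h k _; apply: h; exact: window_uniq.
  move=> h; apply/finalP => s us; have [N hN] := subset_window s.
  exact: (holes_after_anti us (window_uniq N) (hN _ (leqnn _)) (h N I)).
have : mu (F k) @[k --> \oo] --> mu (\bigcap_k F k).
  apply: nonincreasing_cvg_mu => //.
  - by rewrite ltey_eq fin_num_measure.
  - exact: bigcapT_measurable.
  - apply/nonincreasing_seqP => k; apply/subsetPset => w; apply: holes_after_anti.
    + exact: window_uniq.
    + exact: window_uniq.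
    + by move=> x; rewrite !mem_window; lia.
move=> cv; rewrite -lee_fin -probE; last exact: event_final.
rewrite FE -(cvg_lim _ cv) //; apply: lime_ge; first by apply/cvg_ex; eexists; exact: cv.
by apply: nearW => k; rewrite probE; [rewrite lee_fin; exact: prob_holes_after_ge|exact: event_holes_after].
Qed.

Lemma prob_indep3 (a1 a2 a3 : pred int) (Q1 Q2 Q3 : env R -> Prop) :
  (forall x, a1 x -> ~~ a2 x) -> (forall x, a1 x -> ~~ a3 x) -> (forall x, a2 x -> ~~ a3 x) ->
  event Q1 -> event Q2 -> event Q3 ->
  prob (fun w => [/\ Q1 (restr a1 w), Q2 (restr a2 w) & Q3 (restr a3 w)]) =
  prob (fun w => Q1 (restr a1 w)) * prob (fun w => Q2 (restr a2 w)) *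
  prob (fun w => Q3 (restr a3 w)).
Proof.
move=> d12 d13 d23 e1 e2 e3.
pose a : pred int := fun x => a2 x || a3 x.
have r2 w : restr a2 (restr a w) = restr a2 w :> env R.
  by rewrite restr_restr; apply: eq_restr => x; rewrite /= /a; case: (a2 x).
have r3 w : restr a3 (restr a w) = restr a3 w :> env R.
  by rewrite restr_restr; apply: eq_restr => x; rewrite /= /a orbC; case: (a3 x).
pose Q w := Q2 (restr a2 w) /\ Q3 (restr a3 w).
have eQ : event Q.
  by apply: event_and; [exact: (event_restrict _ e2)|exact: (event_restrict _ e3)].
rewrite (prob_ext mu (Q' := fun w => Q1 (restr a1 w) /\ Q (restr a w))); last first.
  by move=> w; rewrite /Q r2 r3; split=> [[]|[? []]].
rewrite (prob_indep mu_law (Q' := Q)) //; last first.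
  by move=> i h; rewrite /on_sites /a negb_or d12 // d13.
rewrite -mulrA; congr (_ * _).
rewrite -(prob_indep mu_law (D1 := on_sites a2) (D2 := on_sites a3)) //; last first.
  by move=> i h; apply: d23.
by apply: prob_ext => w; rewrite /Q -/(restr a w) r2 r3.
Qed.

End Density.

(** * Product formula for a chain of gaps *)

Section ChainProbability.
Variables (R : realType) (mu : probability (env_space R) R) (rb rh p : R).
Hypotheses (mu_law : golf_law rb p mu) (rbh : rb + rh = 1) (p01 : 0 <= p <= 1).
Hypothesis rh_gt0 : 0 < rh.

Local Notation prob := (prob mu).

(** The restriction makes [0] a hole whatever its initial state, so this is the probability, given a
    hole at [0], that no ball from the right fills it. *)
Definition right_free : R := prob (fun w => final (restr (> 0) w) 0).
Definition left_free : R := prob (fun w => final (restr (< 0) w) 0).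

Lemma right_freeE c : prob (fun w => final (restr (> c) w) c) = right_free.
Proof.
rewrite /right_free -[RHS](prob_shift mu_law c); last exact: (event_restrict _ (event_final 0)).
apply: prob_ext => w; rewrite restr_shift final_shift add0r.
by rewrite (@eq_restr R _ (> c)) // => x; rewrite /= subr_gt0.
Qed.

Lemma left_freeE c : prob (fun w => final (restr (< c) w) c) = left_free.
Proof.
rewrite /left_free -[RHS](prob_shift mu_law c); last exact: (event_restrict _ (event_final 0)).
apply: prob_ext => w; rewrite restr_shift final_shift add0r.
by rewrite (@eq_restr R _ (< c)) // => x; rewrite /= subr_lt0.
Qed.

Let prob_hole1 c : prob (fun w => est (restr (pred1 c) w) c = Hole) = rh.
Proof.
rewrite -(prob_hole mu_law rbh c); apply: prob_ext => w.
by rewrite /= /on_sites /= eqxx.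
Qed.

(** Induction along [chain_cons]: each gap contributes [rh] for its right end and the cycle factor
    for its interior, and the last free hole contributes [right_free]. *)
Lemma prob_chain_right c bs : prob (fun w => chain (restr (> c) w) c bs) =
  right_free * \prod_(b <- bs) (rh * (catalan b * (rb * rh) ^+ b)).
Proof.
elim: bs c => [|b bs IH] c; first by rewrite big_nil mulr1 right_freeE.
set c' := c + b.*2.+1%:Z.
rewrite (prob_ext mu (Q' := fun w => [/\ est (restr (pred1 c') w) c' = Hole,
   block (restr (fun x => c < x < c') w) c c' & chain (restr (> c') w) c' bs])); last first.
  by move=> w; rewrite chain_cons /= /on_sites /= eqxx.
rewrite (prob_indep3 mu_law (Q1 := fun w => est w c' = Hole)
  (Q2 := fun w => block w c c') (Q3 := fun w => chain w c' bs)).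
- by rewrite prob_hole1 (prob_block mu_law rbh p01 rh_gt0) IH big_cons; ring.
- by move=> x /= /eqP ->; lia.
- by move=> x /= /eqP ->; lia.
- by move=> x /=; lia.
- exact: event_site.
- exact: event_block.
- exact: event_chain.
Qed.

Lemma prob_chain c bs : prob (fun w => chain w c bs) =
  left_free * rh * right_free * \prod_(b <- bs) (rh * (catalan b * (rb * rh) ^+ b)).
Proof.
rewrite (prob_ext mu (Q' := fun w => [/\ est (restr (pred1 c) w) c = Hole,
   final (restr (< c) w) c & chain (restr (> c) w) c bs])); last first.
  move=> w; rewrite /= /on_sites /= eqxx; split=> [ch|[h f ch]].
    have h := final_hole (chain_final ch).
    by have [f ch'] := (chain_split bs h).1 ch.
  exact/chain_split.
rewrite (prob_indep3 mu_law (Q1 := fun w => est w c = Hole)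
  (Q2 := fun w => final w c) (Q3 := fun w => chain w c bs)).
- by rewrite prob_hole1 left_freeE prob_chain_right; ring.
- by move=> x /= /eqP ->; lia.
- by move=> x /= /eqP ->; lia.
- by move=> x /=; lia.
- exact: event_site.
- exact: event_final.
- exact: event_chain.
Qed.

Lemma free_density_ge : rh - rb <= left_free * rh * right_free.
Proof.
have := prob_final_ge mu_law rbh.
by rewrite (prob_chain 0 [::]) big_nil mulr1.
Qed.

End ChainProbability.

(** * Catalan series *)

Section Catalan.
Variable R : realType.
Local Notation c := (@catalan R).

Lemma catalan0 : c 0 = 1.
Proof. by rewrite /catalan bin0 divr1. Qed.

Lemma catalan_ge0 k : 0 <= c k.
Proof. by rewrite divr_ge0 // ler0n. Qed.

(** The ratio recurrence, from two absorption identities and the symmetry of the middle binomial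
    coefficients of odd order. *)
Lemma catalanS k : k.+2%:R * c k.+1 = (k.*2.+1).*2%:R * c k.
Proof.
rewrite /catalan [LHS]mulrC mulfVK ?pnatr_eq0 // mulrA.
apply: (mulIf (_ : k.+1%:R != 0)); first by rewrite pnatr_eq0.
rewrite mulfVK ?pnatr_eq0 // -!natrM; congr (_%:R).
have e1 := mul_bin_diag k.*2.+2 k; have e2 := mul_bin_diag k.*2.+1 k.
have e3 : 'C(k.*2.+1, k) = 'C(k.*2.+1, k.+1).
  by rewrite -(bin_sub (m := k.+1)); [congr 'C(_, _); lia|lia].
rewrite doubleS; move: e1 e2; rewrite /= e3.
move: ('C(k.*2.+2, k.+1)) ('C(k.*2.+1, k.+1)) ('C(k.*2, k)) => X Y Z e1 e2.
by rewrite mulnC -e1 -doubleS -!doubleMl e2.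
Qed.

Definition convolution (a b : nat -> R) n := \sum_(k < n.+1) a k * b (n - k)%N.

Lemma convolutionC a b n : convolution a b n = convolution b a n.
Proof.
rewrite /convolution (reindex_inj rev_ord_inj) /=; apply: eq_bigr => k _.
by rewrite subSS mulrC; congr (b _ * _); have := ltn_ord k; lia.
Qed.

(** Symmetrising [k] and [n - k] replaces the weight by [(2 * k + 1) + (2 * (n - k) + 1) = 2 * (n +
    1)]. *)
Lemma convolution_odd n :
  2 * convolution (fun k => (k.*2.+1)%:R * c k) c n = (n.+1).*2%:R * convolution c c n.
Proof.
rewrite mulr_natl mulr2n {2}convolutionC /convolution -big_split /= mulr_sumr.
apply: eq_bigr => k _; have kn : (k <= n)%N by rewrite -ltnS.
have -> : (n.+1).*2%:R = (k.*2.+1)%:R + ((n - k).*2.+1)%:R :> R.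
  by rewrite -natrD; congr (_%:R); lia.
by ring.
Qed.

(* With S n the convolution, (n + 2) S n = 2 c n + 4 n S (n - 1): symmetrise the sum of
   the (k + 1) c k c (n - k) and use (k + 1) c k = (4 k - 2) c (k - 1). *)
Lemma catalan_convolution n : convolution c c n = c n.+1.
Proof.
elim: n => [|n IH].
  rewrite /convolution big_ord1 subn0 catalan0 mulr1.
  have two : 2%:R != 0 :> R by rewrite pnatr_eq0.
  by apply: (mulfI two); rewrite (catalanS 0) catalan0.
(* The term [k = 0] is split off and [catalanS] lowers the index in all others. *)
have E : convolution (fun k => k.+1%:R * c k) c n.+1 =
    c n.+1 + 2 * convolution (fun k => (k.*2.+1)%:R * c k) c n.
  rewrite {1}/convolution big_ord_recl /= catalan0 !mul1r subn0; congr (_ + _).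
  rewrite /convolution mulr_sumr; apply: eq_bigr => k _.
  by rewrite /= /bump /= add1n subSS catalanS -muln2 natrM; ring.
rewrite convolution_odd IH in E.
have D : 2 * convolution (fun k => k.+1%:R * c k) c n.+1 =
    convolution (fun k => (k.*2.+1)%:R * c k) c n.+1 + convolution c c n.+1.
  rewrite /convolution mulr_sumr -big_split /=; apply: eq_bigr => k _.
  by rewrite -muln2 -!natr1 natrM; ring.
have D2 : 2 * (2 * convolution (fun k => k.+1%:R * c k) c n.+1) =
    (n.+3).*2%:R * convolution c c n.+1.
  by rewrite D mulrDr convolution_odd -mulrDl -natrD; congr (_%:R * _); lia.
rewrite E in D2.
have S := catalanS n.+1.
have n3 : (n.+3).*2%:R != 0 :> R by rewrite pnatr_eq0.
apply: (mulfI n3); rewrite -D2 -[(n.+3).*2]muln2 natrM.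
have -> : n.+3%:R * 2%:R * c n.+2 = 2%:R * (n.+3%:R * c n.+2) by ring.
rewrite S.
by rewrite -!muln2 -!natr1 !natrM -!natr1; ring.
Qed.

Lemma series_convolution (a b : nat -> R) n :
  \sum_(m < n) convolution a b m = \sum_(i < n) a i * \sum_(j < n - i) b j.
Proof.
elim: n => [|n IH]; first by rewrite !big_ord0.
rewrite big_ord_recr /= IH /convolution big_ord_recr /= subnn addrA -big_split /=.
rewrite [RHS]big_ord_recr /= subSnn big_ord1; congr (_ + _).
apply: eq_bigr => i _; rewrite subSn ?(ltnW (ltn_ord i)) // big_ord_recr /=.
by rewrite mulrDr.
Qed.

(** Cauchy product of nonnegative series. The triangle of side [n] lies in the square of side [n],
    which lies in the triangle of side [2 * n], so both partial sums have the same limit. *)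
Lemma cvg_convolution (a b : nat -> R) (A B : R) :
  (forall k, 0 <= a k) -> (forall k, 0 <= b k) ->
  \sum_(k < n) a k @[n --> \oo] --> A -> \sum_(k < n) b k @[n --> \oo] --> B ->
  \sum_(k < n) convolution a b k @[n --> \oo] --> A * B.
Proof.
move=> a0 b0 cA cB.
have nd (u : nat -> R) : (forall k, 0 <= u k) ->
    nondecreasing_seq (fun n => \sum_(k < n) u k).
  move=> u0; apply/nondecreasing_seqP => n.
  by rewrite big_ord_recr /= lerDl.
have c0 k : 0 <= convolution a b k by apply: sumr_ge0 => i _; exact: mulr_ge0.
have le m n (u : nat -> R) : (forall k, 0 <= u k) -> (m <= n)%N ->
    \sum_(k < m) u k <= \sum_(k < n) u k by move=> u0 mn; exact: nd.
have cAB : (\sum_(k < n) a k) * (\sum_(k < n) b k) @[n --> \oo] --> A * B.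
  exact: cvgM.
have up n : \sum_(k < n) convolution a b k <= (\sum_(k < n) a k) * (\sum_(k < n) b k).
  rewrite series_convolution mulr_suml; apply: ler_sum => i _.
  by apply: ler_wpM2l => //; apply: le => //; exact: leq_subr.
have dn n : (\sum_(k < n) a k) * (\sum_(k < n) b k) <= \sum_(k < n.*2) convolution a b k.
  rewrite series_convolution -(big_mkord xpredT (fun i => a i * \sum_(j < n.*2 - i) b j)).
  rewrite (big_cat_nat (n := n)) //=; last by lia.
  rewrite big_mkord mulr_suml.
  apply: ler_wpDr.
    by apply: sumr_ge0 => i _; apply: mulr_ge0 => //; apply: sumr_ge0.
  apply: ler_sum => i _; apply: ler_wpM2l => //; apply: le => //.
  by have := ltn_ord i; lia.
have ndAB : nondecreasing_seq (fun n => (\sum_(k < n) a k) * (\sum_(k < n) b k)).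
  apply/nondecreasing_seqP => n; apply: ler_pM; try exact: sumr_ge0;
  by apply: le.
have leAB n : \sum_(k < n) convolution a b k <= A * B.
  apply: le_trans (up n) _; rewrite -(cvg_lim _ cAB) //.
  by apply: nondecreasing_cvgn_le => //; apply/cvg_ex; exists (A * B).
have cC : cvgn (fun n => \sum_(k < n) convolution a b k).
  apply: nondecreasing_is_cvgn; first exact: nd.
  by exists (A * B) => _ [n _ <-].
rewrite (_ : A * B = limn (fun n => \sum_(k < n) convolution a b k)) //.
apply/eqP; rewrite eq_le; apply/andP; split; last by apply: limr_le => //; exact: nearW.
rewrite -(cvg_lim _ cAB) //; apply: limr_le; first by apply/cvg_ex; exists (A * B).
apply: nearW => n; apply: le_trans (dn n) _.
by apply: nondecreasing_cvgn_le => //; exact: nd.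
Qed.

(** * The two generating functions at [rb * rh] *)

Variables (rb rh : R).
Hypotheses (rb_gt0 : 0 < rb) (rbh : rb + rh = 1) (rb_lt : rb < rh).
Let lam := rb * rh.
Let g k := c k * lam ^+ k.
Let h k := (k.*2.+1)%:R * c k * lam ^+ k.

Let rh_gt0 : 0 < rh. Proof. exact: lt_trans rb_lt. Qed.
Let lam_gt0 : 0 < lam. Proof. exact: mulr_gt0. Qed.
Let g_ge0 k : 0 <= g k.
Proof. by rewrite mulr_ge0 ?catalan_ge0 // exprn_ge0 // ltW. Qed.
Let h_ge0 k : 0 <= h k.
Proof. by rewrite /h -mulrA mulr_ge0 ?ler0n //; exact: g_ge0. Qed.

Lemma convolution_geometric (a b : nat -> R) n :
  convolution (fun k => a k * lam ^+ k) (fun k => b k * lam ^+ k) n =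
  convolution a b n * lam ^+ n.
Proof.
rewrite /convolution mulr_suml; apply: eq_bigr => k _.
have kn : (k <= n)%N by rewrite -ltnS.
by rewrite mulrACA -exprD subnKC.
Qed.

(** Truncated form of the quadratic equation [lam * G ^ 2 = G - 1]. *)
Lemma catalan_series_conv n :
  lam * \sum_(k < n) convolution g g k = \sum_(k < n.+1) g k - 1.
Proof.
have g0 : g 0 = 1 by rewrite /g expr0 catalan0 mulr1.
rewrite big_ord_recl [g ord0]g0 addrAC subrr add0r mulr_sumr.
apply: eq_bigr => k _; rewrite convolution_geometric catalan_convolution /=.
by rewrite /g /= /bump add1n exprS mulrCA.
Qed.

(** The number [1 / rh] is a fixed point of the increasing map [x -> 1 + lam * x ^ 2], and the
    partial sum of order [n + 1] is at most the image of that of order [n]. *)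
Lemma catalan_series_le n : \sum_(k < n) g k <= rh^-1.
Proof.
elim: n => [|n IH]; first by rewrite big_ord0 invr_ge0 ltW.
have -> : \sum_(k < n.+1) g k = lam * (\sum_(k < n) convolution g g k) + 1.
  by rewrite catalan_series_conv subrK.
have -> : rh^-1 = lam * (rh^-1 * rh^-1) + 1.
  have r0 : rh != 0 by exact: lt0r_neq0.
  by rewrite -{1}(mul1r rh^-1) -{1}rbh /lam; field.
rewrite lerD2r ler_pM2l // series_convolution.
apply: le_trans (_ : (\sum_(k < n) g k) * rh^-1 <= _); last first.
  by apply: ler_wpM2r => //; rewrite invr_ge0 ltW.
rewrite mulr_suml; apply: ler_sum => i _; apply: ler_wpM2l => //.
apply: le_trans IH; rewrite -(big_mkord xpredT g) -(big_mkord xpredT g).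
rewrite [X in _ <= X](big_cat_nat (n := (n - i)%N)) //= ?leq_subr //.
by rewrite lerDl; apply: sumr_ge0.
Qed.

(** The limit solves the quadratic equation, whose roots are [1 / rh] and [1 / rb]; the bound on
    partial sums excludes the larger root [1 / rb]. *)
Lemma cvg_catalan_series : \sum_(k < n) g k @[n --> \oo] --> rh^-1.
Proof.
have cv : cvgn (fun n => \sum_(k < n) g k).
  apply: nondecreasing_is_cvgn.
    by apply/nondecreasing_seqP => n; rewrite big_ord_recr /= lerDl.
  by exists rh^-1 => _ [n _ <-]; exact: catalan_series_le.
have /cvg_ex[/= G cG] := cv.
have Gle : G <= rh^-1.
  rewrite -(cvg_lim _ cG) //; apply: limr_le => //; apply: nearW => n.
  exact: catalan_series_le.
have q : lam * (G * G) = G - 1.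
  have c1 : lam * (\sum_(k < n) convolution g g k) @[n --> \oo] --> lam * (G * G).
    by apply: cvgMr; exact: cvg_convolution.
  have c2 : \sum_(k < n.+1) g k - 1 @[n --> \oo] --> G - 1.
    apply: cvgB; last exact: cvg_cst.
    by have := cG; rewrite -(cvg_shiftS (fun n => \sum_(k < n) g k)).
  have e : (fun n => lam * \sum_(k < n) convolution g g k) =
      (fun n => \sum_(k < n.+1) g k - 1) by apply/funext => n; exact: catalan_series_conv.
  by rewrite e in c1; exact: (cvg_unique _ c1 c2).
have r0 : rh != 0 by exact: lt0r_neq0.
have : (rh * G - 1) * (rb * G - 1) = 0.
  have -> : (rh * G - 1) * (rb * G - 1) = lam * (G * G) - (rb + rh) * G + 1 by rewrite /lam; ring.
  by rewrite q rbh; ring.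
move=> /eqP; rewrite mulf_eq0 => /orP[] /eqP /subr0_eq e.
  by rewrite (_ : rh^-1 = G) //; apply: (mulfI r0); rewrite divff.
exfalso; have : rb * G <= rb * rh^-1 by rewrite ler_pM2l.
by rewrite e leNgt ltr_pdivrMr // mul1r rb_lt.
Qed.

Lemma Gfun_lam : Gfun lam = rh^-1.
Proof.
rewrite /Gfun; apply: cvg_lim => //.
rewrite (_ : series _ = (fun n => \sum_(k < n) g k)); first exact: cvg_catalan_series.
by apply/funext => n; rewrite /series /= big_mkord.
Qed.

(** The limit follows from [2 * lam * H * G = H - G], which is the derivative of the quadratic
    equation written with [H = 2 * a * G' + G]. The bound [M] will come from probabilities summing
    to at most one. *)
Lemma cvg_odd_catalan_series M : (forall n, \sum_(k < n) h k <= M) ->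
  \sum_(k < n) h k @[n --> \oo] --> (rh * (rh - rb))^-1.
Proof.
move=> hM.
have cv : cvgn (fun n => \sum_(k < n) h k).
  apply: nondecreasing_is_cvgn.
    by apply/nondecreasing_seqP => n; rewrite big_ord_recr /= lerDl.
  by exists M => _ [n _ <-].
have /cvg_ex[/= H cH] := cv.
(* Coefficientwise both sides have [2 * (n + 1) * c (n + 1)], on the right as the difference of the
   weights [2 * (n + 1) + 1] and [1]. *)
have e n : 2 * lam * (\sum_(k < n) convolution h g k) =
    \sum_(k < n.+1) h k - \sum_(k < n.+1) g k.
  rewrite -sumrB big_ord_recl /h /g /= mul1r subrr add0r mulr_sumr.
  apply: eq_bigr => k _; rewrite convolution_geometric /= /bump add1n.
  rewrite -mulrA (mulrCA lam) -exprS mulrA convolution_odd catalan_convolution.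
  by rewrite -!muln2 -!natr1 !natrM -!natr1; ring.
have q : 2 * lam * (H * rh^-1) = H - rh^-1.
  have c1 : 2 * lam * (\sum_(k < n) convolution h g k) @[n --> \oo] --> 2 * lam * (H * rh^-1).
    by apply: cvgMr; apply: cvg_convolution => //; exact: cvg_catalan_series.
  have c2 : \sum_(k < n.+1) h k - \sum_(k < n.+1) g k @[n --> \oo] --> H - rh^-1.
    apply: cvgB.
      by have := cH; rewrite -(cvg_shiftS (fun n => \sum_(k < n) h k)).
    by have := cvg_catalan_series; rewrite -(cvg_shiftS (fun n => \sum_(k < n) g k)).
  rewrite (_ : (fun n => _) = (fun n => \sum_(k < n.+1) h k - \sum_(k < n.+1) g k)) in c1.
    exact: (cvg_unique _ c1 c2).
  by apply/funext.
have r0 : rh != 0 by exact: lt0r_neq0.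
have d0 : rh - rb != 0 by rewrite lt0r_neq0 // subr_gt0.
rewrite (_ : _^-1 = H) //.
apply: (mulfI (mulf_neq0 r0 d0)); rewrite divff ?mulf_neq0 //.
have q' : 2 * rb * H = H - rh^-1.
  by rewrite -q /lam; field.
have -> : rh * (rh - rb) * H = rh * ((rb + rh) * H - 2 * rb * H) by ring.
by rewrite rbh q' mul1r opprB addrC subrK divff.
Qed.

Lemma Hfun_lam M : (forall n, \sum_(k < n) h k <= M) -> Hfun lam = (rh * (rh - rb))^-1.
Proof.
move=> hM; rewrite /Hfun; apply: cvg_lim => //.
rewrite (_ : series _ = (fun n => \sum_(k < n) h k)); first exact: cvg_odd_catalan_series hM.
by apply/funext => n; rewrite /series /= big_mkord.
Qed.

(** The second hypothesis bounds the partial sums by [1 / K]; in the limit this gives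
    [K <= rh * (rh - rb)], the reverse of the first. *)
Lemma Hfun_inv K : rh * (rh - rb) <= K -> (forall n, K * \sum_(k < n) h k <= 1) ->
  K = (Hfun lam)^-1.
Proof.
move=> Kge hK.
have d0 : 0 < rh * (rh - rb) by rewrite mulr_gt0 // subr_gt0.
have K0 : 0 < K by exact: lt_le_trans Kge.
have hM n : \sum_(k < n) h k <= K^-1 by rewrite -[K^-1]mulr1 ler_pdivlMl.
rewrite (Hfun_lam hM) invrK; apply/eqP; rewrite eq_le Kge andbT.
rewrite -lef_pV2 ?posrE //.
have cH := cvg_odd_catalan_series hM.
rewrite -(cvg_lim _ cH) //; apply: limr_le; first by apply/cvg_ex; eexists; exact: cH.
exact: nearW.
Qed.

End Catalan.

(** * The gaps around the origin *)

Section Gaps.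
Variable R : realType.
Implicit Types (w : env R) (b : int -> nat).

Definition gaps w (Rr : nat) b := gaps_event (est w) (eclk w) (estp w) Rr b.

Definition chain_site (u : nat -> nat) c k : int := c + \sum_(j < k) ((u j).*2.+1)%:Z.

Lemma chain_siteS u c k : chain_site u c k.+1 = chain_site u c k + ((u k).*2.+1)%:Z.
Proof. by rewrite /chain_site big_ord_recr /= addrA. Qed.

Lemma chain_site_recl u c k :
  chain_site u c k.+1 = chain_site (u \o succn) (c + ((u 0%N).*2.+1)%:Z) k.
Proof. by rewrite /chain_site big_ord_recl /= addrA. Qed.

Lemma chainP w u c n : chain w c (mkseq u n) <->
  final w (chain_site u c 0) /\ forall k, (k < n)%N ->
    no_final w (chain_site u c k) (chain_site u c k.+1) /\ final w (chain_site u c k.+1).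
Proof.
have site0 v x : chain_site v x 0 = x by rewrite /chain_site big_ord0 addr0.
rewrite site0; elim: n u c => [|n IH] u c; first by split=> [|[]].
have -> : mkseq u n.+1 = u 0%N :: mkseq (u \o succn) n.
  by rewrite /mkseq /= (iotaDl 1 0) -map_comp.
split=> /= [[fc ng /IH[fc' h]]|[fc h]].
- split => // -[_|k kn]; first by rewrite chain_siteS site0.
  by rewrite (chain_site_recl u c k) (chain_site_recl u c k.+1); exact: h.
- have [] := h 0%N isT; rewrite chain_siteS site0 => ng fc'; split => //.
  by apply/IH; split => // k kn; rewrite -(chain_site_recl u c k) -(chain_site_recl u c k.+1); exact: h.
Qed.

Lemma chain_site_final w u c n k : chain w c (mkseq u n) -> (k <= n)%N ->
  final w (chain_site u c k).
Proof. by move=> /chainP[f0 h]; case: k => [//|k kn]; case: (h k kn). Qed.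

Definition gap_seq (Rr : nat) b : nat -> nat := fun j => b (j%:Z - Rr%:Z).

(** Position of the leftmost hole of index [-Rr] when the hole of index [0] sits at [-j]; the [Rr]
    gaps to its left are subtracted. *)
Definition first_site (Rr : nat) b (j : nat) : int :=
  - j%:Z - \sum_(k < Rr) ((gap_seq Rr b k).*2.+1)%:Z.

Lemma gap_seq0 Rr b : gap_seq Rr b Rr = b 0.
Proof. by rewrite /gap_seq subrr. Qed.

Lemma chain_site_origin Rr b j : chain_site (gap_seq Rr b) (first_site Rr b j) Rr = - j%:Z.
Proof. by rewrite /chain_site /first_site subrK. Qed.

(** Decomposition by the position [-j] of the hole of index [0]: the next hole, at
    [-j + 2 * b 0 + 1], is positive iff [j <= 2 * b 0]. *)
Lemma gapsP w Rr b : gaps w Rr b <-> exists2 j : nat, j \in iota 0 (b 0).*2.+1 &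
  chain w (first_site Rr b j) (mkseq (gap_seq Rr b) Rr.*2.+1).
Proof.
split=> [[h [h0 [h1 H]]]|[j]].
- pose c := h (- Rr%:Z).
  have hq k : (k <= Rr.*2.+1)%N -> h (k%:Z - Rr%:Z) = chain_site (gap_seq Rr b) c k.
    elim: k => [|k IH] kR; first by rewrite /chain_site big_ord0 addr0 sub0r.
    rewrite chain_siteS -IH ?(ltnW kR) // /gap_seq.
    have [|_ _ _ _] := H (k%:Z - Rr%:Z); first by lia.
    have -> : k%:Z - Rr%:Z + 1 = k.+1%:Z - Rr%:Z by lia.
    by lia.
  have h01 : h 1 = h 0 + (b 0).*2.+1%:Z.
    by have [|_ _ _ _] := H 0; [lia|rewrite add0r; lia].
  have ce : c = first_site Rr b (absz (h 0)).
    have /hq : (Rr <= Rr.*2.+1)%N by lia.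
    have -> : h (Rr%:Z - Rr%:Z) = h 0 by rewrite subrr.
    rewrite /chain_site /first_site; move: (\sum_(_ < _) _) => S; lia.
  exists (absz (h 0)); first by rewrite mem_iota; lia.
  rewrite -ce; apply/chainP; split.
    rewrite -hq // sub0r; have [|//] := H (- Rr%:Z); lia.
  move=> k kR; rewrite -!hq //; last exact: ltnW.
  have [|_ h2 _ h4 _] := H (k%:Z - Rr%:Z); first by lia.
  by have -> : k.+1%:Z - Rr%:Z = k%:Z - Rr%:Z + 1 by lia.
- rewrite mem_iota => jb ch.
  pose q := chain_site (gap_seq Rr b) (first_site Rr b j).
  have q0 : q Rr = - j%:Z by exact: chain_site_origin.
  have q1 : q Rr.+1 = - j%:Z + (b 0).*2.+1%:Z by rewrite /q chain_siteS -/q q0 gap_seq0.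
  (* Only the indices from [-Rr] to [Rr + 1] matter, and there the absolute value is harmless. *)
  pose h (i : int) := q (absz (i + Rr%:Z)).
  have hE (i : int) k : i = k%:Z - Rr%:Z -> h i = q k by move=> ->; rewrite /h subrK.
  exists h; rewrite (hE 0 Rr) ?subrr // (hE 1 Rr.+1); last by lia.
  rewrite q0 q1; split; first by lia.
  split; first by lia.
  move=> i iR; have [k ki] : exists k : nat, i = k%:Z - Rr%:Z by exists (absz (i + Rr%:Z)); lia.
  rewrite (hE i k) // (hE (i + 1) k.+1); last by lia.
  have kR : (k < Rr.*2.+1)%N by lia.
  have f0 := chain_site_final ch (ltnW kR).
  have [_ /(_ k kR)[ng f1]] := (chainP _ _ _ _).1 ch.
  split => //; first by rewrite /q chain_siteS; lia.
  by rewrite /q chain_siteS ki /gap_seq; lia.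
Qed.

Lemma gaps_origin w Rr b j :
  chain w (first_site Rr b j) (mkseq (gap_seq Rr b) Rr.*2.+1) ->
  [/\ final w (- j%:Z), final w (- j%:Z + (b 0).*2.+1%:Z) &
      no_final w (- j%:Z) (- j%:Z + (b 0).*2.+1%:Z)].
Proof.
move=> ch; have Rlt : (Rr < Rr.*2.+1)%N by lia.
have := chain_site_final ch (ltnW Rlt); rewrite chain_site_origin => f0.
have [_ /(_ Rr Rlt)] := (chainP _ _ _ _).1 ch.
by rewrite chain_siteS chain_site_origin gap_seq0 => -[].
Qed.

(** Makes the decomposition disjoint, both over the position [j] and over the length of the gap
    around the origin. *)
Lemma straddling_unique w (x y x' y' : int) : x <= 0 -> 0 < y -> x' <= 0 -> 0 < y' ->
  final w x -> final w y -> no_final w x y ->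
  final w x' -> final w y' -> no_final w x' y' -> x = x' /\ y = y'.
Proof.
move=> x0 y0 x0' y0' fx fy n fx' fy' n'; split.
- case: (ltgtP x x') => // h; exfalso; [apply: (n x') => //|apply: (n' x) => //]; lia.
- case: (ltgtP y y') => // h; exfalso; [apply: (n' y) => //|apply: (n y') => //]; lia.
Qed.

Lemma event_gaps Rr b : event (fun w : env R => gaps w Rr b).
Proof.
apply: (@eq_event _ _ (fun w => exists j, j \in iota 0 (b 0).*2.+1 /\
  chain w (first_site Rr b j) (mkseq (gap_seq Rr b) Rr.*2.+1))).
  by move=> w; rewrite gapsP; split=> [[j]|[j []]]; exists j.
by apply: event_exists => j; apply: event_and; [exact: event_const|exact: event_chain].
Qed.

(** * Probability of a sequence of gaps and its normalisation *)

Variables (mu : probability (env_space R) R) (rb rh p : R).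
Hypotheses (mu_law : golf_law rb p mu) (rbh : rb + rh = 1) (p01 : 0 <= p <= 1).
Hypotheses (rb_gt0 : 0 < rb) (rb_lt : rb < rh).
Local Notation lam := (rb * rh).

Let rh_gt0 : 0 < rh. Proof. exact: lt_trans rb_lt. Qed.

(** The constant [K]: the first three factors are the density of free holes, and the last [rh] is
    the one attached to the gap around the origin. *)
Definition free_pair : R := left_free mu * rh * right_free mu * rh.

Lemma prob_gaps Rr b : prob mu (fun w => gaps w Rr b) =
  (b 0).*2.+1%:R * catalan (b 0) * lam ^+ b 0 * free_pair *
  \prod_(0 <= j < Rr.*2.+1 | j != Rr)
    (rh * (catalan (b (j%:Z - Rr%:Z)) * lam ^+ b (j%:Z - Rr%:Z))).
Proof.
rewrite (prob_ext mu (Q' := fun w => exists2 j : nat, j \in iota 0 (b 0).*2.+1 &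
  chain w (first_site Rr b j) (mkseq (gap_seq Rr b) Rr.*2.+1))); last by move=> w; exact: gapsP.
rewrite -prob_exclusive ?iota_uniq //; last 2 first.
- by move=> j; exact: event_chain.
- move=> w i j; rewrite !mem_iota => ib jb /gaps_origin[a1 a2 a3] /gaps_origin[b1 b2 b3].
  have [] := straddling_unique _ _ _ _ a1 a2 a3 b1 b2 b3; lia.
(* The probability of a chain does not depend on its first site, so the sum over [j] is a
   multiplication by [2 * b 0 + 1]. *)
rewrite (eq_bigr _ (fun j _ => prob_chain mu_law rbh p01 rh_gt0 _ _)).
rewrite big_const_seq count_predT size_iota iter_addr_0 -mulr_natl /mkseq big_map.
rewrite -[iota 0 _]/(index_iota 0 Rr.*2.+1) (bigD1_seq Rr) ?iota_uniq //=; last first.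
  by rewrite mem_iota; lia.
by rewrite gap_seq0 /free_pair /gap_seq; move: (\prod_(_ <- _ | _) _) => pr; ring.
Qed.

Lemma free_pair_eq : free_pair = (Hfun lam)^-1.
Proof.
apply: Hfun_inv => //.
  rewrite mulrC /free_pair ler_pM2r //.
  exact: (free_density_ge mu_law rbh p01 rh_gt0).
(* With radius [0] only the gap around the origin is prescribed and the product over the other gaps
   is empty; these events are disjoint in [k]. *)
move=> n; pose E (k : nat) w := gaps w 0 (fun=> k).
have eE k : event (E k) by exact: event_gaps.
have := @prob_exclusive R mu nat (iota 0 n) E (iota_uniq _ _) eE.
move=> exc; apply: (@le_trans _ _ (\sum_(k <- iota 0 n) prob mu (E k))); last first.
  rewrite exc; last first.
    move=> w i j _ _ /gapsP[i' + /gaps_origin[a1 a2 a3]] /gapsP[j' + /gaps_origin[b1 b2 b3]].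
    rewrite !mem_iota => ib jb.
    have [] := straddling_unique _ _ _ _ a1 a2 a3 b1 b2 b3; lia.
  apply: prob_le1; apply: (@eq_event _ _ (fun w => exists k, k \in iota 0 n /\ E k w)).
    by move=> w; split=> [[k]|[k []]]; exists k.
  by apply: event_exists => k; apply: event_and; [exact: event_const|exact: eE].
rewrite mulr_sumr -(big_mkord xpredT (fun k => free_pair * (k.*2.+1%:R * catalan k * lam ^+ k))).
rewrite /index_iota subn0; apply: ler_sum => k _.
rewrite prob_gaps big_mkcond big_nat1 /= mulr1 mulrC.
exact: lexx.
Qed.

Lemma prob_gapsE Rr b : prob mu (fun w => gaps w Rr b) =
  ((b 0).*2.+1)%:R * catalan (b 0) * lam ^+ (b 0) / Hfun lam *
  \prod_(0 <= j < Rr.*2.+1 | j != Rr)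
     (catalan (b (j%:Z - Rr%:Z)) * lam ^+ (b (j%:Z - Rr%:Z)) / Gfun lam).
Proof.
rewrite prob_gaps free_pair_eq; congr (_ * _); apply: eq_bigr => j _.
by rewrite Gfun_lam // invrK mulrC.
Qed.

End Gaps.

Unset Implicit Arguments.

Theorem mainTheorem6 (d : measure_display) (T : measurableType d) (R : realType)
  (P : probability T R) (rb rh p : R)
  (st : int -> T -> site) (clk : int -> T -> R) (stp : int -> nat -> T -> bool) :
  0 < rb -> 0 <= rh -> 0 <= p <= 1 ->
  rb + rh = 1 -> rb < rh ->
  golf_randomness P rb rh p st clk stp ->
  let lam := rb * rh in
  forall (Rr : nat), (0 < Rr)%N ->
  forall b : int -> nat,
    P [set w | gaps_event (fun x => st x w) (fun x => clk x w) (fun x k => stp x k w) Rr b]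
    = ((((b 0).*2.+1)%:R * catalan (b 0) * lam ^+ (b 0) / Hfun lam) *
       \prod_(0 <= j < Rr.*2.+1 | j != Rr)
          (catalan (b (j%:Z - Rr%:Z)) * lam ^+ (b (j%:Z - Rr%:Z)) / Gfun lam))%:E.
Proof.
move=> rb_gt0 _ p01 rbh rb_lt golf lam Rr _ b.
have [mu mu_law muE] := golf_transfer rbh golf.
rewrite -(prob_gapsE mu_law rbh p01 rb_gt0 rb_lt) -probE; last exact: event_gaps.
exact: (muE _ (event_gaps Rr b)).
Qed.
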